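(* Given a graph $G$, the following are equivalent: (i) the line graph $L(G)$ is in $1$-$HNG$; (ii) $G$ contains no element of $\mathcal{A}$ as a (not necessarily induced) subgraph; (iii) $G$ is a (not necessarily induced) subgraph of a graph in $\mathcal{L}$.
   Context: All graphs are finite and simple. $\chi$ is the chromatic number and $\theta(G)=\chi(\overline{G})$ the clique cover number. A graph $G$ is in the class $1$-$HNG$ if every induced subgraph $H$ of $G$ (including $G$ itself) satisfies $\chi(H)+\theta(H)\ge |V(H)|$. The line graph $L(G)$ has the edges of $G$ as vertices, two being adjacent when they share an endpoint in $G$. $P_k$, $C_k$ and $K_k$ are the path, cycle and complete graph on $k$ vertices, $K_{k,l}$ is the complete bipartite graph, $+$ is disjoint union, and $kH$ is the disjoint union of $k$ copies of $H$. A pendant vertex is a vertex of degree one; a ''cluster of pendant vertices at $v$'' means an arbitrary number $k\ge 0$ of new vertices each adjacent only to $v$. ''Appending $P_k$ at $v$'' means adding a path on $k$ vertices, one endpoint of which is $v$ and the other $k-1$ vertices of which are new. ''Appending $K_3$ at $v$'' means adding two new vertices adjacent to each other and to $v$. The set $\mathcal{A}$ is $\{A_1,\dots,A_6, 3P_3, P_5+P_3, P_7, C_6, K_4, C_4+P_3, 2K_3, 2K_{1,3}, K_{2,3}, K_3+K_{1,3}\}$, where: $A_1$ is $K_4$ minus an edge together with one pendant vertex attached to a vertex of degree two; $A_2$ is the 7-vertex tree with vertices $u,w,m$, edges $um$ and $wm$, and two pendant vertices at each of $u$ and $w$; $A_3$ is a triangle with one vertex $v$ joined to a new vertex $x$,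 where $x$ has two further pendant neighbors; $A_4$ is $C_4$ with one pendant vertex attached to each of two opposite vertices; $A_5$ is the 5-cycle $c_1c_2c_3c_4c_5$ together with the chord $c_2c_5$ and one pendant vertex attached to $c_1$; $A_6$ is a triangle with $P_3$ appended at one vertex and one pendant vertex attached to each of the other two vertices. The set $\mathcal{L}$ is the union of the families $L_1,\dots,L_{11}$; each family consists of the graphs described below, to which an arbitrary number of disjoint $K_2$ components may be added: $L_1$: $C_5$ with one chord, and a cluster of pendant vertices at one endpoint of the chord; $L_2$: $C_4$ with one chord, with $P_3$ appended at, and a cluster of pendant vertices at, one and the same endpoint of the chord; $L_3$: $C_4$ with $K_3$ appended at, and a cluster of pendant vertices at, one and the same vertex; $L_4$: a triangle with $P_4$ appended at, and a cluster of pendant vertices at, one and the same vertex; $L_5$: an arbitrary positive number of triangles all sharing one common vertex and otherwise disjoint, with a cluster of pendant vertices at the common vertex; $L_6$: a triangle $vab$ with $P_3$ appended at $v$, a cluster of pendant vertices at $v$, and one pendant vertex at $a$; $L_7$: a triangle $vab$ with $P_3$ appended at $v$ and a cluster of pendant vertices at $a$; $L_8$: a triangle with a cluster of pendant vertices at one vertex and one pendant vertex at each of the other two vertices; $L_9$: the path $P_6$ with vertices $v_1,\dots,v_6$ in order, a cluster of pendant vertices at $v_3$, and one pendant vertex at $v_4$; $L_{10}$: the disjoint union of $P_4$ and a triangle with a cluster of pendant vertices at one vertex; $L_{11}$: the disjoint union of $P_4$ and a second copy of $P_4$ having a cluster of pendant vertices at one of its two center (inner) vertices and a single pendant vertex attached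 to the other center vertex.
   Formalization: In L_11 the second P_4 has only a cluster of pendant vertices at one center vertex; the additional single pendant vertex at the other center is dropped, since with it and a nonempty cluster the graph contains 3P_3, an element of A, so (iii) would not imply (ii). *)

(* Defs.v *)
From mathcomp Require Import all_boot.

Set Implicit Arguments.
Unset Strict Implicit.
Unset Printing Implicit Defensive.

Record sgraph := SGraph {
  vert :> finType;
  adj : rel vert;
  adj_sym : symmetric adj;
  adj_irr : irreflexive adj }.

(** * Chromatic and clique cover numbers *)

Definition colorable (G : sgraph) (k : nat) : bool :=
  [exists f : {ffun G -> 'I_k},
     [forall x, forall y, adj x y ==> (f x != f y)]].

Lemma colorable_ex (G : sgraph) : exists k, colorable G k.
Proof.
exists #|G|; apply/existsP; exists [ffun x => enum_rank x].
apply/forallP => x; apply/forallP => y; apply/implyP => xy.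
rewrite !ffunE; apply/eqP => /enum_rank_inj exy.
by rewrite exy adj_irr in xy.
Qed.

Definition chi (G : sgraph) : nat := ex_minn (colorable_ex G).

Section Complement.
Variable G : sgraph.
Definition compl_adj (x y : G) : bool := (x != y) && ~~ adj x y.
Lemma compl_sym : symmetric compl_adj.
Proof. by move=> x y; rewrite /compl_adj eq_sym adj_sym. Qed.
Lemma compl_irr : irreflexive compl_adj.
Proof. by move=> x; rewrite /compl_adj eqxx. Qed.
Definition compl : sgraph := SGraph compl_sym compl_irr.
End Complement.

Definition theta (G : sgraph) : nat := chi (compl G).

(** * Induced subgraphs and the class 1-HNG *)

Section Induced.
Variables (G : sgraph) (S : {set G}).
Definition induced_adj (x y : {x : G | x \in S}) : bool := adj (val x) (val y).
Lemma induced_sym : symmetric induced_adj.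
Proof. by move=> x y; rewrite /induced_adj adj_sym. Qed.
Lemma induced_irr : irreflexive induced_adj.
Proof. by move=> x; rewrite /induced_adj adj_irr. Qed.
Definition induced : sgraph := SGraph induced_sym induced_irr.
End Induced.

Definition one_HNG (G : sgraph) : Prop :=
  forall S : {set G}, #|induced S| <= chi (induced S) + theta (induced S).

(** * Line graphs *)

Section Line.
Variable G : sgraph.
Definition edges : {set {set G}} := [set [set x; y] | x in G, y in G & adj x y].
Definition line_adj (e f : {e : {set G} | e \in edges}) : bool :=
  (e != f) && (val e :&: val f != set0).
Lemma line_sym : symmetric line_adj.
Proof. by move=> e f; rewrite /line_adj eq_sym setIC. Qed.
Lemma line_irr : irreflexive line_adj.
Proof. by move=> e; rewrite /line_adj eqxx. Qed.
Definition line : sgraph := SGraph line_sym line_irr.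
End Line.

(** * Subgraphs, not necessarily induced *)

Definition subgraph (H G : sgraph) : Prop :=
  exists2 f : H -> G, injective f & forall x y, adj x y -> adj (f x) (f y).

(** * Constructions *)

(* [symgraph r] has an edge between x != y as soon as r x y or r y x. *)
Section SymGraph.
Variables (T : finType) (r : rel T).
Definition symgraph_adj (x y : T) : bool := (x != y) && (r x y || r y x).
Lemma symgraph_sym : symmetric symgraph_adj.
Proof. by move=> x y; rewrite /symgraph_adj eq_sym orbC. Qed.
Lemma symgraph_irr : irreflexive symgraph_adj.
Proof. by move=> x; rewrite /symgraph_adj eqxx. Qed.
Definition symgraph : sgraph := SGraph symgraph_sym symgraph_irr.
End SymGraph.

Definition path_graph (n : nat) : sgraph :=
  symgraph (fun i j : 'I_n => j == i.+1 :> nat).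

Definition cycle_graph (n : nat) : sgraph :=
  symgraph (fun i j : 'I_n => j == i.+1 %% n :> nat).

Definition complete (n : nat) : sgraph := symgraph (fun _ _ : 'I_n => true).

Definition complete_bip (k l : nat) : sgraph :=
  symgraph (fun x y : 'I_k + 'I_l => is_inl x && ~~ is_inl y).

Definition dunion (G H : sgraph) : sgraph :=
  symgraph (fun x y : G + H =>
    match x, y with
    | inl u, inl v => adj u v
    | inr u, inr v => adj u v
    | _, _ => false
    end).

Definition copies (k : nat) (H : sgraph) : sgraph :=
  symgraph (fun x y : 'I_k * H => (x.1 == y.1) && adj x.2 y.2).

Definition add_edge (G : sgraph) (u v : G) : sgraph :=
  symgraph (fun x y : G => adj x y || (x == u) && (y == v)).
Arguments add_edge : clear implicits.

Definition del_edge (G : sgraph) (u v : G) : sgraph :=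
  symgraph (fun x y : G => adj x y && ([set x; y] != [set u; v])).
Arguments del_edge : clear implicits.

(* The disjoint union of G and H, with v joined to the vertices of H in N. *)
Definition attach (G : sgraph) (v : G) (H : sgraph) (N : pred H) : sgraph :=
  symgraph (fun x y : G + H =>
    match x, y with
    | inl u, inl w => adj u w
    | inr u, inr w => adj u w
    | inl u, inr w => (u == v) && N w
    | inr _, inl _ => false
    end).
Arguments attach : clear implicits.

Definition pendants (G : sgraph) (v : G) (k : nat) : sgraph :=
  attach G v (copies k (complete 1)) predT.
Arguments pendants : clear implicits.

(* One endpoint of the appended path on k vertices is v itself, so only k - 1
   vertices are new. *)
Definition append_path (G : sgraph) (v : G) (k : nat) : sgraph :=
  attach G v (path_graph k.-1) (fun i => i == 0 :> nat).
Arguments append_path : clear implicits.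

Definition append_K3 (G : sgraph) (v : G) : sgraph :=
  attach G v (complete 2) predT.
Arguments append_K3 : clear implicits.

(* t triangles sharing exactly one vertex, namely [inl ord0]. *)
Definition windmill (t : nat) : sgraph :=
  attach (complete 1) ord0 (copies t (complete 2)) predT.

(* Vertices of graphs on 'I_n are numbered from 0, along the path or cycle when
   there is one.  In [attach G v H N] and the constructions derived from it, a
   vertex u of G becomes [inl u]. *)
Notation "''v[' n ]_ i" := (@Ordinal n i isT)
  (at level 8, n, i at level 2, format "''v[' n ]_ i").

Inductive in_A : sgraph -> Prop :=
| A1 : in_A (pendants (del_edge (complete 4) 'v[4]_0 'v[4]_1) 'v[4]_0 1)
| A2 : in_A (pendants (pendants (path_graph 3) 'v[3]_0 2) (inl 'v[3]_2) 2)
| A3 : in_A (pendants (pendants (complete 3) 'v[3]_0 1) (inr (ord0, ord0)) 2)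
| A4 : in_A (pendants (pendants (cycle_graph 4) 'v[4]_0 1) (inl 'v[4]_2) 1)
| A5 : in_A (pendants (add_edge (cycle_graph 5) 'v[5]_1 'v[5]_4) 'v[5]_0 1)
| A6 : in_A (pendants (pendants (append_path (complete 3) 'v[3]_0 3)
                         (inl 'v[3]_1) 1) (inl (inl 'v[3]_2)) 1)
| A_3P3 : in_A (copies 3 (path_graph 3))
| A_P5_P3 : in_A (dunion (path_graph 5) (path_graph 3))
| A_P7 : in_A (path_graph 7)
| A_C6 : in_A (cycle_graph 6)
| A_K4 : in_A (complete 4)
| A_C4_P3 : in_A (dunion (cycle_graph 4) (path_graph 3))
| A_2K3 : in_A (copies 2 (complete 3))
| A_2K13 : in_A (copies 2 (complete_bip 1 3))
| A_K23 : in_A (complete_bip 2 3)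
| A_K3_K13 : in_A (dunion (complete 3) (complete_bip 1 3)).

(* The members of L_1, ..., L_11 without additional K_2 components; k is the
   size of the cluster of pendant vertices. *)
Inductive in_L0 : sgraph -> Prop :=
| L1 k : in_L0 (pendants (add_edge (cycle_graph 5) 'v[5]_1 'v[5]_4) 'v[5]_1 k)
| L2 k : in_L0 (pendants (append_path (add_edge (cycle_graph 4) 'v[4]_0 'v[4]_2)
                            'v[4]_0 3) (inl 'v[4]_0) k)
| L3 k : in_L0 (pendants (append_K3 (cycle_graph 4) 'v[4]_0) (inl 'v[4]_0) k)
| L4 k : in_L0 (pendants (append_path (complete 3) 'v[3]_0 4) (inl 'v[3]_0) k)
| L5 t k : 0 < t -> in_L0 (pendants (windmill t) (inl ord0) k)
| L6 k : in_L0 (pendants (pendants (append_path (complete 3) 'v[3]_0 3)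
                            (inl 'v[3]_0) k) (inl (inl 'v[3]_1)) 1)
| L7 k : in_L0 (pendants (append_path (complete 3) 'v[3]_0 3) (inl 'v[3]_1) k)
| L8 k : in_L0 (pendants (pendants (pendants (complete 3) 'v[3]_0 k)
                            (inl 'v[3]_1) 1) (inl (inl 'v[3]_2)) 1)
| L9 k : in_L0 (pendants (pendants (path_graph 6) 'v[6]_2 k) (inl 'v[6]_3) 1)
| L10 k : in_L0 (dunion (path_graph 4) (pendants (complete 3) 'v[3]_0 k))
(* The single pendant vertex at the center 'v[4]_2 of the second path is the end
   'v[4]_3 of that path.  A further pendant vertex there would, for k > 0, give
   a graph containing 3P_3, which belongs to A. *)
| L11 k : in_L0 (dunion (path_graph 4) (pendants (path_graph 4) 'v[4]_1 k)).

Inductive in_L : sgraph -> Prop :=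
| InL H m : in_L0 H -> in_L (dunion H (copies m (complete 2))).

(* Main.v *)
Require Import Defs.
From mathcomp Require Import all_boot.

Set Implicit Arguments.
Unset Strict Implicit.
Unset Printing Implicit Defensive.

(* Write f(F) for the sum of the chromatic index of an edge set F and of the
   number of stars and triangles needed to cover it, so that (i) says
   |F| <= f(F) for all F.

   (i) => (ii): each member of A violates this inequality, by a finite check.

   (ii) => (iii): by induction on the number of edges, one may delete a K_2
   component, or a pendant edge at a vertex v of degree at least 5: in any
   embedding of the rest in a member of L the vertex v, which still has degree
   at least 4, is the centre of the cluster, so the edge can be put back.  In
   the remaining graphs, a vertex v of degree at least 5 has no pendant
   neighbour; if every other vertex has at most one neighbour besides v, the
   graph lies in a windmill, and otherwise a star with five leaves at v, a P_3
   avoiding v and one more edge at each of the leaves force a member of A.  If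
   all degrees are at most 4, the graphs without a member of A are enumerated
   edge by edge, starting from P_3; there are finitely many of them.

   (iii) => (i): for a cluster with centre c, a colouring uses at least deg(c)
   colours, all pendant edges beyond the first one are counted by deg(c), and
   each K_2 component needs its own clique; this leaves the subgraphs of the
   base graphs with at most one pendant edge at c.

   The finite parts are executed on codes: a graph on {0, ..., n - 1} is given
   by n and the list of its edges (i, j) with i < j. *)

(** * Codes of graphs and the finite searches *)

Definition code := (nat * seq (nat * nat))%type.

Definition wf (H : code) := all (fun p => p.1 < p.2 < H.1) H.2.

Definition sE (E : seq (nat * nat)) (i j : nat) := ((i, j) \in E) || ((j, i) \in E).

Definition code_rel (n : nat) (r : rel nat) : code :=
  (n, [seq p <- allpairs pair (iota 0 n) (iota 0 n) | (p.1 < p.2) && (r p.1 p.2 || r p.2 p.1)]).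

Definition shift (n : nat) (E : seq (nat * nat)) := [seq (n + p.1, n + p.2) | p <- E].

Definition code_attach (G : code) (v : nat) (H : code) (N : pred nat) : code :=
  (G.1 + H.1, G.2 ++ shift G.1 H.2 ++ [seq (v, G.1 + i) | i <- iota 0 H.1 & N i]).

Definition code_path n := code_rel n (fun i j => j == i.+1).
Definition code_cycle n := code_rel n (fun i j => j == i.+1 %% n).
Definition code_complete n := code_rel n (fun _ _ => true).
Definition code_bip k l := code_rel (k + l) (fun i j => (i < k) && (k <= j)).
Definition code_union G H := code_attach G 0 H pred0.
Definition code_pendants G v k := code_attach G v (k, [::]) predT.
Definition code_append_path G v k := code_attach G v (code_path k.-1) (fun i => i == 0).
Definition code_append_K3 G v := code_attach G v (code_complete 2) predT.
Definition code_add (G : code) u v : code := (G.1, rcons G.2 (u, v)).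
Definition code_copies k (H : code) : code :=
  (k * H.1, flatten [seq shift (i * H.1) H.2 | i <- iota 0 k]).
Definition code_del (G : code) u v : code := (G.1, [seq p <- G.2 | p != (u, v)]).

(* Forbidden graphs, ordered by how often they occur in the searches below. *)
Definition Acodes : seq code := Eval vm_compute in [::
  code_pendants (code_pendants (code_complete 3) 0 1) 3 2;
  code_pendants (code_del (code_complete 4) 0 1) 0 1;
  code_pendants (code_pendants (code_cycle 4) 0 1) 2 1;
  code_bip 2 3;
  code_path 7;
  code_union (code_path 5) (code_path 3);
  code_copies 3 (code_path 3);
  code_union (code_complete 3) (code_bip 1 3);
  code_copies 2 (code_bip 1 3);
  code_copies 2 (code_complete 3);
  code_union (code_cycle 4) (code_path 3);
  code_complete 4;
  code_cycle 6;
  code_pendants (code_pendants (code_append_path (code_complete 3) 0 3) 1 1) 2 1;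
  code_pendants (code_add (code_cycle 5) 1 4) 0 1;
  code_pendants (code_pendants (code_path 3) 0 2) 2 2].

(* The base graphs of the families other than L_5, each with the centre of its
   cluster. *)
Definition Lcodes : seq (code * nat) := Eval vm_compute in [::
  (code_add (code_cycle 5) 1 4, 1);
  (code_append_path (code_add (code_cycle 4) 0 2) 0 3, 0);
  (code_append_K3 (code_cycle 4) 0, 0);
  (code_append_path (code_complete 3) 0 4, 0);
  (code_pendants (code_append_path (code_complete 3) 0 3) 1 1, 0);
  (code_append_path (code_complete 3) 0 3, 1);
  (code_pendants (code_pendants (code_complete 3) 1 1) 2 1, 0);
  (code_pendants (code_path 6) 3 1, 2);
  (code_union (code_path 4) (code_complete 3), 4);
  (code_union (code_path 4) (code_path 4), 5)].

(* Unlike [has] and [all], these stop at the first decisive element also under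
   call-by-value evaluation. *)
Fixpoint lhas (T : Type) (p : pred T) (s : seq T) : bool :=
  if s is x :: s' then if p x then true else lhas p s' else false.

Fixpoint lall (T : Type) (p : pred T) (s : seq T) : bool :=
  if s is x :: s' then if p x then lall p s' else false else true.

Definition nbrs (E : seq (nat * nat)) (i : nat) : seq nat :=
  pmap (fun p => if p.1 == i then Some p.2
                 else if p.2 == i then Some p.1 else None) E.

Definition adjs (H : code) := [seq nbrs H.2 i | i <- iota 0 H.1].

Definition pattern (a : code) :=
  [seq (size (nbrs a.2 i), [seq j <- iota 0 i | (j, i) \in a.2]) | i <- iota 0 a.1].

(* Entry i of a pattern gives the degree of vertex i and its neighbours among
   the vertices 0, ..., i - 1; g lists the images chosen so far. *)
Fixpoint emb (pat : seq (nat * seq nat)) (ad : seq (seq nat)) (n : nat)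
    (g : seq nat) : bool :=
  if pat is (d, b) :: pat' then
    lhas (fun w =>
        if w \in g then false else
        if size (nth [::] ad w) < d then false else
        if lall (fun j => w \in nth [::] ad (nth 0 g j)) b
        then emb pat' ad n (rcons g w) else false)
      (if b is j :: _ then nth [::] ad (nth 0 g j) else iota 0 n)
  else true.

Definition embeds (a H : code) : bool :=
  if wf a then emb (pattern a) (adjs H) H.1 [::] else false.

Definition Apatterns := Eval vm_compute in map pattern Acodes.

Definition hasA (H : code) : bool :=
  let ad := adjs H in lhas (fun a => emb a ad H.1 [::]) Apatterns.

Definition has_deg5 (H : code) :=
  lhas (fun i => 4 < size (undup (nbrs H.2 i))) (iota 0 H.1).

Definition admissible H := if has_deg5 H then false else ~~ hasA H.

Definition exts1 (H : code) : seq code :=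
  [seq (H.1, p :: H.2) |
     p <- allpairs pair (iota 0 H.1) (iota 0 H.1) & (p.1 < p.2) && (p \notin H.2)]
  ++ [seq (H.1.+1, (i, H.1) :: H.2) | i <- iota 0 H.1].

(* If no edge touching H is missing, then a whole component is, and it contains
   a P_3, because there are no K_2 components. *)
Definition ext2 (H : code) : code :=
  (H.1.+3, [:: (H.1.+1, H.1.+2), (H.1, H.1.+1) & H.2]).

(** The graphs compared have equally many edges and no isolated vertices, so an embedding of one in
    another is an isomorphism. *)
Definition dedup (l : seq code) : seq code :=
  foldr (fun x acc => if lhas (fun y => embeds y x) acc then acc else x :: acc)
    [::] l.

(** Deleting the hub [v] leaves a matching, as in subgraphs of a windmill with pendant vertices at
    its hub. *)
Definition windmill_like (H : code) : bool :=
  lhas (fun v => lall (fun i => if i == v then true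
                       else count (predC1 v) (nbrs H.2 i) <= 1) (iota 0 H.1))
    (iota 0 H.1).

(* When all degrees are at most 4, four pendant vertices in the cluster are
   enough. *)
Definition inL (H : code) : bool :=
  if windmill_like H then true
  else lhas (fun L => embeds H (code_pendants L.1 L.2 4)) Lcodes.

(* l1 consists of graphs with m edges and l2 of graphs with m + 1 edges. *)
Fixpoint exhaust (fuel : nat) (l1 l2 : seq code) : bool :=
  if nilp l1 && nilp l2 then true else
  if fuel is k.+1 then
    if lall inL l1 then
      exhaust k (dedup (l2 ++ filter admissible (flatten (map exts1 l1))))
        (filter admissible (map ext2 l1))
    else false
  else false.

(** Ten rounds suffice: by then no admissible graph grown from $P_3$ is left, and every one met on
    the way has passed [inL]. *)
Lemma exhaust_path3 : exhaust 10 [:: code_path 3] [::].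
Proof. by vm_compute. Qed.

(** The pair is stored in increasing order to keep the code well formed; [w = H.1] introduces a new
    vertex. *)
Definition addE (H : code) i w : code :=
  (maxn H.1 w.+1, (minn i w, maxn i w) :: H.2).

(** Each leaf without a second neighbour receives one other than the centre 0, either an old vertex
    or the new label [H.1]; every branch has to end in a graph containing a member of A. *)
Fixpoint leaves (l : seq nat) (H : code) : bool :=
  if hasA H then true else
  if l is i :: l' then
    if 1 < size (nbrs H.2 i) then leaves l' H else
    lall (fun w => if w == i then true else leaves l' (addE H i w)) (iota 1 H.1)
  else false.

Definition star5 : seq (nat * nat) := [seq (0, i) | i <- iota 1 5].

(* The P_3 avoiding the centre 0 of the star is y x z.  Its middle vertex x is
   either a leaf, without loss of generality 1, or not adjacent to 0. *)
Definition star_refuted : bool :=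
  lall (fun x => let H := (maxn 6 x.+1, star5) in
    lall (fun y => if y == x then true else let H := addE H x y in
      lall (fun z => if (z == x) || (z == y) then true
                     else leaves (iota 1 5) (addE H x z))
        (iota 1 H.1))
      (iota 1 H.1))
    [:: 1; 6].

Lemma star_refutedT : star_refuted.
Proof. by vm_compute. Qed.

(** * Soundness of the embedding search *)

Lemma lhasE (T : Type) (p : pred T) s : lhas p s = has p s.
Proof. by elim: s => //= x s ->. Qed.

Lemma lallE (T : Type) (p : pred T) s : lall p s = all p s.
Proof. by elim: s => //= x s ->. Qed.

Lemma sEC E i j : sE E i j = sE E j i.
Proof. by rewrite /sE orbC. Qed.

Lemma wfP H p : wf H -> p \in H.2 -> p.1 < p.2 < H.1.
Proof. by move=> /allP h /h. Qed.

Lemma sE_lt H i j : wf H -> sE H.2 i j -> (i < H.1) && (j < H.1).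
Proof.
move=> wfH; wlog ij : i j / (i, j) \in H.2.
  by move=> h; case/orP=> ij; [|rewrite andbC]; apply: h; rewrite /sE ij ?orbT.
move=> _; case/andP: (wfP wfH ij) => /= h1 h2.
by rewrite h2 (ltn_trans h1 h2).
Qed.

Lemma mem_nbrs H i j : wf H -> (j \in nbrs H.2 i) = sE H.2 i j.
Proof.
case: H => n E; rewrite /nbrs /sE /wf /=.
elim: E => //= -[a b] E IH /andP[/= /andP[ab _] wfE].
rewrite !inE /= !xpair_eqE.
case: (eqVneq a i) => [ai|ai] /=.
  by rewrite inE IH // -ai (ltn_eqF ab) andbF /= orbA.
case: (eqVneq b i) => [bi|bi] /=.
  by rewrite inE IH // andbT orbCA.
by rewrite IH // andbF.
Qed.

(** Soundness of the search: a successful run extends [g] by a list [h] of images respecting all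
    recorded edges. The bound on the pattern says that recorded neighbours come earlier, so
    [nth 0 g j] is an image already chosen. A candidate comes from [iota 0 n] or from the adjacency
    list of an earlier image, whence the disjunction. *)
Lemma embP pat ad n g :
  emb pat ad n g -> uniq g ->
  (forall k, k < size pat ->
     all (gtn (size g + k)) (nth (0, [::]) pat k).2) ->
  exists h, [/\ size h = size pat, uniq (g ++ h),
    forall w, w \in h -> w < n \/ exists k, w \in nth [::] ad k
    & forall k, k < size pat -> forall j, j \in (nth (0, [::]) pat k).2 ->
      nth 0 (g ++ h) (size g + k) \in nth [::] ad (nth 0 (g ++ h) j)].
Proof.
elim: pat g => [|[d b] pat IH] g /=.
  by move=> _ ug _; exists [::]; split=> //; rewrite cats0.
rewrite lhasE => /hasP[w wC]; case: ifP => // wg; case: ifP => // _.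
rewrite lallE; case: ifP => // /allP wb hemb ug hpat.
have ug' : uniq (rcons g w) by rewrite rcons_uniq wg.
have [k kp|h [sh uh rh ah]] := IH _ hemb ug'.
  by have := hpat k.+1 kp; rewrite size_rcons addSnnS.
exists (w :: h); rewrite -cat_rcons; split=> //=.
- by rewrite sh.
- move=> x; rewrite inE => /orP[/eqP->|/rh//].
  case: b wC {wb hpat} => [|j b]; first by rewrite mem_iota; left.
  by right; exists (nth 0 g j).
- case=> [_ j jb|k kp j jk]; last first.
    by have := ah k kp j jk; rewrite size_rcons addSnnS.
  have jg : j < size g.
    by have /allP/(_ _ jb) := hpat 0 isT; rewrite addn0.
  rewrite addn0 !nth_cat size_rcons ltnSn leqW //.
  by rewrite !nth_rcons ltnn eqxx jg wb.
Qed.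

Lemma patternP a H : wf a -> wf H -> emb (pattern a) (adjs H) H.1 [::] ->
  exists g : nat -> nat,
    [/\ {in gtn a.1 &, injective g}, forall i, i < a.1 -> g i < H.1
      & forall p, p \in a.2 -> sE H.2 (g p.1) (g p.2)].
Proof.
move=> wfa wfH /embP[//|k|h []].
  rewrite size_map size_iota => ka; rewrite (nth_map 0) ?size_iota //=.
  by rewrite nth_iota //; apply/allP => j; rewrite mem_filter mem_iota => /and3P[].
rewrite !size_map !size_iota /= => sh uh rh ah.
have mem_ad w k : w \in nth [::] (adjs H) k -> sE H.2 k w.
  case: (ltnP k H.1) => kn; last by rewrite nth_default // size_map size_iota.
  by rewrite (nth_map 0) ?size_iota // nth_iota // mem_nbrs.
exists (nth 0 h); split.
- move=> i j; rewrite !inE => ia ja /eqP.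
  by rewrite nth_uniq ?sh // => /eqP.
- move=> i ia; have /rh : nth 0 h i \in h by rewrite mem_nth // sh.
  by case=> // -[k /mem_ad/(sE_lt wfH)/andP[]].
- case=> i j ij /=; have /andP[/= lt_ij ja] := wfP wfa ij.
  apply: mem_ad; apply: (ah j) => //.
  rewrite (nth_map 0) ?size_iota //= nth_iota // mem_filter ij mem_iota /=.
  by rewrite lt_ij.
Qed.

Lemma embedsP a H : embeds a H -> wf H ->
  wf a /\ exists g : nat -> nat,
    [/\ {in gtn a.1 &, injective g}, forall i, i < a.1 -> g i < H.1
      & forall p, p \in a.2 -> sE H.2 (g p.1) (g p.2)].
Proof.
by rewrite /embeds; case: ifP => // wfa emb wfH; split=> //; apply: patternP.
Qed.

Lemma Apatterns_def : Apatterns = map pattern Acodes.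
Proof. by vm_compute. Qed.

Lemma Acodes_wf : all wf Acodes.
Proof. by vm_compute. Qed.

Lemma hasAP H : hasA H -> wf H ->
  exists2 a, a \in Acodes & exists g : nat -> nat,
    [/\ {in gtn a.1 &, injective g}, forall i, i < a.1 -> g i < H.1
      & forall p, p \in a.2 -> sE H.2 (g p.1) (g p.2)].
Proof.
rewrite /hasA lhasE Apatterns_def has_map => /hasP[a aA hemb] wfH; exists a => //.
by apply: patternP => //; have /allP := Acodes_wf; apply.
Qed.

(** * The structure of graphs without a member of A *)

(** The map [s] embeds [H] as a not necessarily induced subgraph; only its values below [H.1]
    matter. *)
Definition cont (T : finType) (e : rel T) (H : code) (s : nat -> T) : Prop :=
  [/\ wf H, {in gtn H.1 &, injective s}
    & forall p, p \in H.2 -> e (s p.1) (s p.2)].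

Definition has_code (T : finType) (e : rel T) (H : code) : Prop :=
  exists s, cont e H s.

Definition Afree (T : finType) (e : rel T) : Prop :=
  forall a, a \in Acodes -> ~ has_code e a.

(* Isolated vertices and K_2 components are harmless here: they can be put
   into triangles of the windmill. *)
Definition fit_windmill (T : finType) (e : rel T) : Prop :=
  exists P : pred T, (forall x y, P x -> P y -> x = y) /\
    forall x y z, ~~ P x -> ~~ P y -> ~~ P z -> e x y -> e x z -> y = z.

(* The labels below L.1.1 are the vertices of the base graph L.1, whose vertex
   L.2 carries the cluster; L.1.1 labels the cluster and L.1.1.+1 the isolated
   vertices and the K_2 components. *)
Definition fit (T : finType) (e : rel T) (L : code * nat) : Prop :=
  exists f : T -> nat,
    (forall x y, f x = f y -> f x < L.1.1 -> x = y) /\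
    forall x y, e x y -> sE ((L.2, L.1.1) :: L.1.2) (f x) (f y) \/
      [/\ f x = L.1.1.+1, f y = L.1.1.+1 & forall z, e x z -> z = y].

Definition fits (T : finType) (e : rel T) : Prop :=
  fit_windmill e \/ exists2 L, L \in Lcodes & fit e L.

Lemma Lcodes_wf : all (fun L => [&& wf L.1, uniq L.1.2 & L.2 < L.1.1]) Lcodes.
Proof. by vm_compute. Qed.

Lemma wf_pendants G v k : wf G -> v < G.1 -> wf (code_pendants G v k).
Proof.
move=> wfG vG; rewrite /wf /= all_cat all_map; apply/andP; split.
  by apply: sub_all wfG => p /= /andP[-> h]; apply: leq_trans h (leq_addr _ _).
rewrite all_filter; apply/allP => i; rewrite mem_iota /= => ik.
by rewrite (leq_trans vG (leq_addr _ _)) ltn_add2l.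
Qed.

Lemma mem_pendants G v k p : p \in (code_pendants G v k).2 ->
  p \in G.2 \/ exists t, p = (v, G.1 + t).
Proof.
rewrite /= mem_cat => /orP[->|/mapP[t _ ->]]; first by left.
by right; exists t.
Qed.

Section Structure.
Variables (T : finType) (e : rel T).
Hypotheses (esym : symmetric e) (eirr : irreflexive e).

Lemma cont_sE H s i j : cont e H s -> sE H.2 i j -> e (s i) (s j).
Proof. by case=> _ _ h /orP[/h|/h] //=; rewrite esym. Qed.

Lemma cont_embedding a H s (g : nat -> nat) : wf a -> cont e H s ->
    {in gtn a.1 &, injective g} -> (forall i, i < a.1 -> g i < H.1) ->
    (forall p, p \in a.2 -> sE H.2 (g p.1) (g p.2)) ->
  cont e a (s \o g).
Proof.
move=> wfa cH gi gn gE; split=> // [i j ia ja /= eqs|p pa]; last first.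
  exact: cont_sE cH (gE _ pa).
by apply: gi => //; case: cH => _ si _; apply: si; rewrite ?inE //; apply: gn.
Qed.

Lemma cont_embeds a H s : embeds a H -> cont e H s -> has_code e a.
Proof.
move=> aH cH; have [wfH _ _] := cH.
by have [wfa [g [gi gn gE]]] := embedsP aH wfH; exists (s \o g); apply: cont_embedding cH _ _ _.
Qed.

Lemma Afree_hasA H s : Afree e -> cont e H s -> hasA H = false.
Proof.
move=> Ae cH; apply/negP => hA; have [wfH _ _] := cH.
have [a aA [g [gi gn gE]]] := hasAP hA wfH; apply: (Ae a aA).
by exists (s \o g); apply: cont_embedding cH _ _ _ => //; apply: (allP Acodes_wf).
Qed.

(** If [x] is dropped, the entry kept in its place embeds in [x], hence in every graph containing
    [x]. *)
Lemma dedupP l x : x \in l -> has_code e x ->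
  exists2 y, y \in dedup l & has_code e y.
Proof.
move=> + [s cx]; elim: l => //= z l IH.
rewrite inE lhasE => /orP[/eqP<-|/IH[y yd hy]].
  case: ifP => [/hasP[y yd yx]|_]; last by exists x; [rewrite mem_head | exists s].
  by exists y => //; apply: cont_embeds yx cx.
by exists y => //; case: ifP => // _; rewrite inE yd orbT.
Qed.

Lemma cont_isolated H s w : cont e H s -> (forall k, k < H.1 -> s k <> w) ->
  cont e (H.1.+1, H.2) (fun k => if k == H.1 then w else s k).
Proof.
case: H => n E [/= wfH si sEe] sw; split=> /=.
- apply: sub_all wfH => p /= /andP[-> /ltnW]; exact.
- move=> j k; rewrite !inE !ltnS (leq_eqVlt j) (leq_eqVlt k).
  case: (eqVneq j n) => [->|jn]; case: (eqVneq k n) => [->|kn] //= kl jl.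
  + by move=> eqw; case: (sw k jl).
  + by move=> eqw; case: (sw j kl).
  + by move=> eqs; apply: si.
- move=> p pE; have /andP[p12 p2] := wfP wfH pE.
  by rewrite (ltn_eqF (ltn_trans p12 p2)) (ltn_eqF p2); apply: sEe.
Qed.

Lemma cont_add_edge H s p : cont e H s -> p.1 < p.2 < H.1 -> e (s p.1) (s p.2) ->
  cont e (H.1, p :: H.2) s.
Proof.
case: H => n E [/= wfH si sEe] pn ep; split=> //=; first by rewrite /wf /= pn.
by move=> q; rewrite inE => /orP[/eqP->|/sEe].
Qed.

Lemma cont_add_vertex H s i w : cont e H s -> i < H.1 -> e (s i) w ->
    (forall k, k < H.1 -> s k <> w) ->
  cont e (H.1.+1, (i, H.1) :: H.2) (fun k => if k == H.1 then w else s k).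
Proof.
move=> cH iH eiw /(cont_isolated cH) cw.
have := cont_add_edge (p := (i, H.1)) cw.
by rewrite /= iH ltnSn eqxx (ltn_eqF iH); apply.
Qed.

(** All edges are covered; isolated vertices may be missed. *)
Definition spanning (H : code) (s : nat -> T) :=
  forall u w, e u w ->
    exists i j, [/\ i < H.1, j < H.1, u = s i, w = s j & sE H.2 i j].

Lemma in_imageP (s : nat -> T) n w :
  (exists2 k, k < n & s k = w) \/ (forall k, k < n -> s k <> w).
Proof.
case: (boolP [exists k : 'I_n, s k == w]) => [/existsP[k /eqP sk]|/existsPn sk].
  by left; exists k.
by right=> k kn /eqP; apply/negP/(sk (Ordinal kn)).
Qed.

(** Take an edge [u w] not covered by [s]. If it touches the image, adding it gives a member of
    [exts1]. Otherwise some third vertex [z] is adjacent to one of its ends: if [z] is in the image,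
    an edge leaves the image, and if not, there is a $P_3$ disjoint from the image, as in [ext2]. *)
Lemma extend H s : cont e H s ->
    (forall u w, e u w -> exists z, (z != w) && e u z || (z != u) && e w z) ->
  [\/ spanning H s, exists2 x, x \in exts1 H & has_code e x | has_code e (ext2 H)].
Proof.
move=> cH noK2; have [wfH si sEe] := cH.
pose cov u w := [exists i : 'I_H.1, exists j : 'I_H.1,
  [&& s i == u, s j == w & sE H.2 i j]].
case: (boolP [exists u, exists w, e u w && ~~ cov u w]) => [|/existsPn sp]; last first.
  constructor 1 => u w uw; have /existsPn/(_ w) := sp u.
  rewrite uw /= negbK => /existsP[i /existsP[j /and3P[/eqP iu /eqP jw ij]]].
  by exists i, j; split.
case/existsP=> u /existsP[w /andP[uw ncov]].
have inn i : i < H.1 -> i \in iota 0 H.1 by rewrite mem_iota.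
have ext_new i z : i < H.1 -> e (s i) z -> (forall k, k < H.1 -> s k <> z) ->
    exists2 x, x \in exts1 H & has_code e x.
  move=> iH siz zn; exists (H.1.+1, (i, H.1) :: H.2).
    by rewrite mem_cat; apply/orP; right; apply/mapP; exists i => //; apply: inn.
  by eexists; apply: cont_add_vertex siz zn.
have [[i iH iu]|un] := in_imageP s H.1 u; have [[j jH jw]|wn] := in_imageP s H.1 w.
- constructor 2.
  have nij : sE H.2 i j = false.
    apply/negP => ij; case/negP: ncov; apply/existsP; exists (Ordinal iH).
    by apply/existsP; exists (Ordinal jH); rewrite /= iu jw !eqxx.
  wlog ij : i j iH jH u w iu jw uw nij {ncov} / i < j.
    move=> h; case: (ltngtP i j) => [ij|ji|ij]; first exact: (h i j iH jH u w).
      by apply: (h j i jH iH w u) => //; rewrite 1?esym // sEC.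
    by move: uw; rewrite -iu -jw ij eirr.
  exists (H.1, (i, j) :: H.2).
    rewrite mem_cat; apply/orP; left; apply: map_f; rewrite mem_filter /= ij.
    case/norP: (negbT nij) => -> _ /=.
    by apply/allpairsP; exists (i, j); rewrite !inn.
  by exists s; apply: cont_add_edge => //=; rewrite ?ij ?iu ?jw.
- by constructor 2; apply: ext_new iH _ wn; rewrite iu.
- by constructor 2; apply: ext_new jH _ un; rewrite jw esym.
have [z zuw] := noK2 u w uw.
wlog {zuw} /andP[zw uz] : u w uw ncov un wn z zuw / (z != w) && e u z.
  move=> h; case/orP: (zuw) => [zuw'|zwu]; first exact: (h u w uw ncov un wn z).
  apply: (h w u _ _ wn un z); rewrite ?zwu ?orbT 1?esym //.
  apply: contra ncov => /existsP[i /existsP[j /and3P[si' sj ij]]].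
  by apply/existsP; exists j; apply/existsP; exists i; rewrite si' sj sEC.
have [[i iH iz]|zn] := in_imageP s H.1 z.
  by constructor 2; apply: ext_new iH _ un; rewrite iz esym.
constructor 3.
have c1 := cont_isolated cH zn.
have ez k : k < H.1.+1 -> (if k == H.1 then z else s k) <> u.
  rewrite ltnS leq_eqVlt; case: eqP => [_ _ zu|_ /= kH]; last exact: un.
  by move: uz; rewrite -zu eirr.
have := cont_add_vertex c1 (ltnSn _) _ ez; rewrite /= eqxx esym uz => /(_ isT) c2.
have ew k : k < H.1.+2 -> (if k == H.1.+1 then u else if k == H.1 then z else s k) <> w.
  rewrite ltnS leq_eqVlt; case: eqP => [_ _ uw'|_ /=]; first by move: uw; rewrite uw' eirr.
  rewrite ltnS leq_eqVlt; case: eqP => [_ _ zw'|_ /= kH]; last exact: wn.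
  by rewrite zw' eqxx in zw.
have := cont_add_vertex c2 (ltnSn _) _ ew; rewrite /= eqxx uw => /(_ isT) c3.
by eexists; apply: c3.
Qed.

Lemma spanning_inL H s : cont e H s -> spanning H s -> inL H -> fits e.
Proof.
move=> cH sp; have [wfH si _] := cH; rewrite /inL.
have sinj i j : i < H.1 -> j < H.1 -> s i = s j -> i = j by move=> iH jH; apply: si.
case: ifP => [wl _|_].
  left; move: wl; rewrite /windmill_like lhasE => /hasP[v]; rewrite mem_iota => vH.
  rewrite lallE => /allP wl; exists (pred1 (s v)); split.
    by move=> x y /eqP-> /eqP->.
  move=> x y z xv yv zv exy exz.
  have [i [j [iH jH xi yj ij]]] := sp _ _ exy.
  have [i' [k [iH' kH xi' zk ik]]] := sp _ _ exz.
  have ii' : i' = i by apply: sinj => //; rewrite -xi.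
  move: (wl i); rewrite mem_iota iH ii' in ik * => /(_ isT).
  have iv : i != v by apply: contraNneq xv => <-; rewrite /= xi.
  have jv : j != v by apply: contraNneq yv => <-; rewrite /= yj.
  have kv : k != v by apply: contraNneq zv => <-; rewrite /= zk.
  rewrite (negPf iv) -size_filter.
  have : j \in filter (predC1 v) (nbrs H.2 i) by rewrite mem_filter /= jv mem_nbrs.
  have : k \in filter (predC1 v) (nbrs H.2 i) by rewrite mem_filter /= kv mem_nbrs.
  case: (filter _ _) => [|a [|]] //; rewrite !inE => /eqP ka /eqP ja _.
  by rewrite yj zk ka ja.
rewrite lhasE => /hasP[[[n B] c] LL hemb]; right; exists (n, B, c) => //.
have /allP/(_ _ LL)/and3P[/= wfB _ cn] := Lcodes_wf.
have wfC := wf_pendants 4 wfB (cn : c < (n, B).1).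
have [_ [g [gi gn gE]]] := embedsP hemb wfC.
(* Truncation at [n] merges the labels of the four pendant vertices into the cluster label. Vertices
   missed by [s] are isolated and get [n.+1]. *)
pose f x := if [pick i : 'I_H.1 | s i == x] is Some i then minn (g i) n else n.+1.
have fs i : i < H.1 -> f (s i) = minn (g i) n.
  move=> iH; rewrite /f; case: pickP => [j /eqP sj|/(_ (Ordinal iH))]; last by rewrite eqxx.
  by congr (minn (g _) n); apply: sinj => //.
exists f; split=> [x y fxy|x y exy] /=.
  have fin z : f z < n -> exists2 i, i < H.1 & s i = z.
    rewrite /f; case: pickP => [i /eqP <- _|_]; first by exists i.
    by rewrite ltnNge leqnSn.
  move=> fxn; have [i iH ix] := fin x fxn.
  move: fxn (fxn); rewrite {2}fxy => /= fxn /fin[j jH jy].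
  rewrite -ix -jy in fxy fxn *; rewrite !fs // in fxy fxn.
  congr s; apply: gi => //; move: fxy fxn.
  rewrite /minn; case: ltnP => _; case: ltnP => _ //= h; rewrite ?ltnn // => gn'.
  by move: gn'; rewrite h ltnn.
left; have [i [j [iH jH -> -> ij]]] := sp _ _ exy; rewrite !fs //.
have {ij} : sE (code_pendants (n, B) c 4).2 (g i) (g j).
  by case/orP: ij => /gE //=; rewrite sEC.
have {}fC a b : (a, b) \in (code_pendants (n, B) c 4).2 ->
    (minn a n, minn b n) \in (c, n) :: B.
  case/mem_pendants=> /= [ab|[t [-> ->]]].
    have /andP[/= h1 h2] := wfP wfB ab.
    have mn k : k < n -> minn k n = k by move=> /ltnW/minn_idPl.
    by rewrite !mn ?(ltn_trans h1 h2) // inE ab orbT.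
  have -> : minn c n = c by apply/minn_idPl/ltnW.
  by have -> : minn (n + t) n = n by [apply/minn_idPr/leq_addr]; rewrite mem_head.
by case/orP=> /fC h; rewrite /sE h ?orbT.
Qed.

End Structure.

(** * Following the two finite searches inside a given graph *)

Section Searches.
Variables (T : finType) (e : rel T).
Hypotheses (esym : symmetric e) (eirr : irreflexive e) (eA : Afree e).

Lemma cont_deg H s i : cont e H s -> i < H.1 ->
  size (undup (nbrs H.2 i)) <= #|e (s i)|.
Proof.
move=> cH iH; have [wfH si _] := cH.
rewrite -(size_map s) -(card_uniqP _); last first.
  rewrite map_inj_in_uniq ?undup_uniq // => j k.
  rewrite !mem_undup !mem_nbrs // => /(sE_lt wfH)/andP[_ jH] /(sE_lt wfH)/andP[_ kH].
  exact: si.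
apply: subset_leq_card; apply/subsetP => w /mapP[j].
by rewrite mem_undup mem_nbrs // => ij ->; exact: (cont_sE esym cH ij).
Qed.

(** Invariant: some graph in the current lists is contained in [e]. If it covers all edges, [inL]
    settles [e]. Otherwise [extend] yields a larger one, which is admissible because [e] has degrees
    at most 4 and no member of A, so the next lists again contain such a graph. They can therefore
    never both be empty before [e] is settled. *)
Lemma exhaustP fuel l1 l2 x :
    (forall v, #|e v| <= 4) ->
    (forall u w, e u w -> exists z, (z != w) && e u z || (z != u) && e w z) ->
  exhaust fuel l1 l2 -> x \in l1 ++ l2 -> has_code e x -> fits e.
Proof.
move=> deg4 noK2; elim: fuel l1 l2 x => [|fuel IH] l1 l2 x /=.
  by case: ifP => // /andP[/nilP-> /nilP->].
case: ifP => [/andP[/nilP-> /nilP->]//|_]; case: ifP => // l1L hex.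
have adm y : has_code e y -> admissible y.
  case=> s cy; rewrite /admissible (Afree_hasA esym eA cy); case: ifP => //.
  rewrite /has_deg5 lhasE => /hasP[i]; rewrite mem_iota => iH.
  by rewrite ltnNge (leq_trans (cont_deg cy iH)).
have in1 y : y \in l2 ++ filter admissible (flatten (map exts1 l1)) ->
    has_code e y -> fits e.
  move=> yl hy; have [z zd hz] := dedupP esym yl hy.
  by apply: IH hex _ hz; rewrite mem_cat zd.
rewrite mem_cat => /orP[xl|xl] hx; last by apply: in1 hx; rewrite mem_cat xl.
have [s cx] := hx.
case: (extend esym eirr cx noK2) => [sp|[y yx hy]|hy].
- by apply: (spanning_inL cx sp); move: l1L; rewrite lallE => /allP; apply.
- apply: in1 (hy); rewrite mem_cat mem_filter adm //.
  by apply/orP; right; apply/flattenP; exists (exts1 x); rewrite ?map_f.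
- apply: (IH _ _ _ hex _ hy); rewrite mem_cat mem_filter adm //=.
  by apply/orP; right; apply: map_f.
Qed.

(** The label [k] is the old label of [w] if there is one, and [H.1] otherwise; this is why the
    searches range up to [H.1]. *)
Lemma cont_addE H s i w : cont e H s -> i < H.1 -> e (s i) w ->
  exists k s', [/\ k < H.1.+1, cont e (addE H i k) s', s' k = w
    & forall j, j < H.1 -> s' j = s j].
Proof.
move=> cH iH eiw; have [[k kH kw]|wn] := in_imageP s H.1 w.
  exists k, s; rewrite ltnS (ltnW kH); split=> //.
  rewrite /addE (maxn_idPl kH); apply: cont_add_edge => //=.
    case: (ltngtP i k) => [ik|ki|ik]; rewrite ?ik ?ki ?iH ?kH //.
    by move: eiw; rewrite -kw ik eirr.
  by case: (ltngtP i k) => [ik|ki|ik]; rewrite ?kw -?ik // 1?esym // -?kw ?ik //;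
    move: eiw; rewrite -kw ik.
exists H.1, (fun k => if k == H.1 then w else s k).
split; rewrite ?ltnSn ?eqxx //; last by move=> j jH; rewrite (ltn_eqF jH).
rewrite /addE maxnE subSnn addn1 (minn_idPl (ltnW iH)) (maxn_idPr (ltnW iH)).
exact: cont_add_vertex.
Qed.

Lemma addE_lt H i k s : cont e (addE H i k) s -> (k == i) = false.
Proof.
case=> /andP[/= /andP[ik _] _] _ _; apply/negP => /eqP ki.
by move: ik; rewrite ki minnn maxnn ltnn.
Qed.

(** The actual neighbours of the leaves select a branch of [leaves]. This branch reaches a member of
    A contained in [e], which is impossible. *)
Lemma leavesP l H s : leaves l H -> cont e H s -> 0 < H.1 ->
    (forall i, i \in l -> i < H.1 /\ exists2 w, w != s 0 & e (s i) w) ->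
  False.
Proof.
elim: l H s => [|i l IH] H s /= hl cH H0 hs; move: hl.
  by rewrite (Afree_hasA esym eA cH).
have hl j : j \in l -> j < H.1 /\ exists2 w, w != s 0 & e (s j) w.
  by move=> jl; apply: hs; rewrite inE jl orbT.
rewrite (Afree_hasA esym eA cH); case: ifP => _; first by move=> /IH; apply; eassumption.
rewrite lallE => /allP hall.
have [iH [w w0 iw]] := hs i (mem_head _ _).
have [k [s' [kn cs' kw ss']]] := cont_addE cH iH iw.
have := hall k; rewrite mem_iota add1n kn andbT lt0n (addE_lt cs').
case: eqP => [k0|_ /(_ isT) hl']; first by rewrite -kw k0 ss' // eqxx in w0.
apply: (IH _ s' hl' cs') => [|j jl] /=; first by rewrite leq_max H0.
have [jH [z z0 jz]] := hl j jl; split; first by rewrite leq_max jH.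
by exists z; rewrite !ss'.
Qed.

Lemma star_search v x y z : 4 < #|e v| ->
    (forall u, e v u -> exists2 w, w != v & e u w) ->
    x != v -> y != v -> z != v -> y != z -> e x y -> e x z -> False.
Proof.
move=> dv nopend xv yv zv yz exy exz.
(* Five neighbours of [v], with [x] first if it is one of the neighbours of [v], so that [x] then
   has label 1. *)
have [l [sl ul el xl]] : exists l : seq T, [/\ size l = 5, uniq l,
    forall u, u \in l -> e v u & e v x -> nth v l 0 = x].
  case: (boolP (e v x)) => evx; last first.
    exists (take 5 (enum (e v))); split; rewrite ?take_uniq ?enum_uniq //.
      by rewrite size_takel // -cardE.
    by move=> u /mem_take; rewrite mem_enum.
  have xe : x \in enum (e v) by rewrite mem_enum.
  exists (x :: take 4 (rem x (enum (e v)))); split=> //.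
  - by rewrite /= size_takel // size_rem // -cardE -ltnS (ltn_predK dv).
  - rewrite /= take_uniq ?rem_uniq ?enum_uniq // andbT.
    apply/negP => /mem_take; rewrite mem_rem_uniq ?enum_uniq // inE.
    by rewrite eqxx.
  - move=> u; rewrite inE => /orP[/eqP->//|/mem_take/mem_rem].
    by rewrite mem_enum.
pose s := nth v (v :: l).
have vl : v \notin l by apply/negP => /el; rewrite eirr.
have cs : cont e (6, star5) s.
  split=> //= [i j|p /mapP[i]].
    rewrite !inE => i6 j6 /eqP; rewrite nth_uniq /= ?sl // ?vl //.
    by move/eqP.
  rewrite mem_iota => /andP[i1 i6] -> /=; apply: el; rewrite /s.
  by case: i i1 i6 => // i _ i6; rewrite /= mem_nth // sl.
(* If [x] is not adjacent to [v], it is none of the five leaves and gets the new label 6. *)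
have [xi [s1 [xi16 c1 s1x s1s]]] : exists xi s1,
    [/\ xi \in [:: 1; 6], cont e (maxn 6 xi.+1, star5) s1, s1 xi = x
      & forall j, j < 6 -> s1 j = s j].
  case: (boolP (e v x)) => [/xl x0|evx]; first by exists 1, s; split.
  have [[k k6 kx]|xn] := in_imageP s 6 x; last first.
    exists 6, (fun k => if k == 6 then x else s k).
    split=> // [|j j6]; [exact: cont_isolated cs xn | by rewrite (ltn_eqF j6)].
  case: k k6 kx => [|k] k6 kx; first by rewrite -kx eqxx in xv.
  by case/negP: evx; apply: el; rewrite -kx /s /= mem_nth // sl.
have xi_lt : xi < maxn 6 xi.+1 by rewrite leq_max ltnSn orbT.
rewrite -s1x in exy exz.
have s10 : s1 0 = v by rewrite s1s.
have := star_refutedT; rewrite /star_refuted lallE => /allP/(_ _ xi16).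
have [yi [s2 [yi_lt c2 s2y s2s]]] := cont_addE c1 xi_lt exy.
rewrite lallE => /allP/(_ yi); rewrite mem_iota add1n yi_lt andbT lt0n (addE_lt c2).
have s20 : s2 0 = v by rewrite s2s // leq_max.
case: eqP => [y0|_ /(_ isT)]; first by rewrite -s2y y0 s20 eqxx in yv.
have xi_lt2 : xi < (addE (maxn 6 xi.+1, star5) xi yi).1 by rewrite leq_max xi_lt.
rewrite -(s2s xi) // in exz.
have [zi [s3 [zi_lt c3 s3z s3s]]] := cont_addE c2 xi_lt2 exz.
have s30 : s3 0 = v by rewrite s3s // !leq_max.
rewrite lallE => /allP/(_ zi); rewrite mem_iota add1n zi_lt andbT lt0n (addE_lt c3).
case: eqP => [z0|_ /(_ isT)]; first by rewrite -s3z z0 s30 eqxx in zv.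
case: eqP => [zyi|_]; last rewrite orbF.
  have yi_lt2 : yi < (addE (maxn 6 xi.+1, star5) xi yi).1 by rewrite leq_max ltnSn orbT.
  by move: yz; rewrite -s2y -s3z zyi s3s // eqxx.
move/leavesP; apply; [exact: c3 | by rewrite !leq_max | move=> i i15].
have i6 : 0 < i < 6 by move: i15; rewrite !inE => /or4P[|||/orP[]] /eqP->.
have [i0 i6'] := andP i6.
have s3i : s3 i = s i by rewrite s3s ?s2s ?s1s //= !leq_max ?i6'.
split; first by rewrite /= !leq_max i6'.
have [|w wv iw] := nopend (s i).
  by apply: el; rewrite /s; case: i i0 i6' {i15 i6 s3i} => // i _ i6; rewrite /= mem_nth // sl.
by exists w; rewrite ?s30 ?s3i.
Qed.

End Searches.

(** Away from the centre of the cluster, degrees are at most 3 and no pendant vertex of the cluster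
    is adjacent. A vertex with four neighbours can thus only be placed at the centre. *)
Lemma Lcodes_deg : all (fun L => let: (n, B, c) := L in
  all (fun i => (i == c) || (let N := undup (nbrs ((c, n) :: B) i) in
                              (size N <= 3) && (n \notin N))) (iota 0 n.+1)) Lcodes.
Proof. by vm_compute. Qed.

(** * Restoring a deleted component or pendant edge *)

Section Reductions.
Variables (T : finType) (e : rel T).
Hypotheses (esym : symmetric e) (eirr : irreflexive e).

Definition del_rel (x y : T) : rel T :=
  fun a b => e a b && ~~ ((a == x) && (b == y) || (a == y) && (b == x)).

Lemma del_rel_sym x y : symmetric (del_rel x y).
Proof.
by move=> a b; rewrite /del_rel esym orbC (andbC (a == y)) (andbC (a == x)).
Qed.

Lemma del_rel_irr x y : irreflexive (del_rel x y).
Proof. by move=> a; rewrite /del_rel eirr. Qed.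

Lemma sub_del_rel x y : subrel (del_rel x y) e.
Proof. by move=> a b /andP[]. Qed.

Lemma del_relP x y a b : e a b -> (a != x \/ b != y) -> (a != y \/ b != x) ->
  del_rel x y a b.
Proof.
rewrite /del_rel => -> h1 h2; rewrite negb_or !negb_and.
by case: h1 => ->; case: h2 => ->; rewrite ?orbT.
Qed.

Lemma card_del_rel x y : e x y ->
  #|[pred p | del_rel x y p.1 p.2]| < #|[pred p | e p.1 p.2]|.
Proof.
move=> exy; apply: proper_card; apply/properP; split.
  by apply/subsetP => p; rewrite !inE => /sub_del_rel.
by exists (x, y); rewrite !inE //= /del_rel /= !eqxx andbF.
Qed.

Lemma Afree_sub (e' : rel T) : subrel e' e -> Afree e -> Afree e'.
Proof.
move=> sub eA a aA [s [wfa si se]]; case: (eA a aA).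
by exists s; split=> // p /se/sub.
Qed.

(** Both ends have a single neighbour, so the windmill condition survives; in the other families
    both are relabelled as part of a $K_2$ component. *)
Lemma fits_add_K2 x y : e x y -> (forall z, e x z -> z = y) ->
  (forall z, e y z -> z = x) -> fits (del_rel x y) -> fits e.
Proof.
move=> exy xy yx.
have del a b : e a b -> a != x -> a != y -> del_rel x y a b.
  by move=> ab ax ay; apply: del_relP => //; [left|left].
have K2 a : (a == x) || (a == y) -> forall b c, e a b -> e a c -> b = c.
  by move=> /orP[/eqP->|/eqP->] b c; [move=> /xy-> /xy->|move=> /yx-> /yx->].
case=> [[P [Pu Pm]]|[L LL [f [fi fe]]]]; [left|right].
  exists P; split=> // a b c aP bP cP ab ac.
  case: (boolP ((a == x) || (a == y))) => [/K2|/norP[ax ay]]; first exact.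
  by apply: (Pm a) => //; apply: del.
exists L => //; exists (fun a => if (a == x) || (a == y) then L.1.1.+1 else f a).
split=> [a b|a b ab].
  case: ifP => _; first by rewrite ltnNge leqnSn.
  case: ifP => _; last exact: fi.
  by move=> -> ; rewrite ltnNge leqnSn.
case: ifP => axy.
  right; suff -> : (b == x) || (b == y) by split=> // c ac; apply: (K2 a axy).
  by case/orP: axy ab => /eqP-> => [/xy|/yx] ->; rewrite eqxx ?orbT.
have /norP[ax ay] := negbT axy.
case: ifP => [bxy|_].
  by move: ab; rewrite esym; case/orP: bxy => /eqP-> => [/xy|/yx] az; rewrite az eqxx in ax ay.
case: (fe a b (del _ _ ab ax ay)) => [|[fa fb fK]]; first by left.
by right; split=> // c ac; apply: fK; apply: del.
Qed.

(** At least four neighbours remain at [v] after the deletion, which forces [v] to be the hub or the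
    centre of the cluster; [p] can then join the cluster. *)
Lemma fits_add_pendant p v : e p v -> (forall z, e p z -> z = v) -> 4 < #|e v| ->
  fits (del_rel p v) -> fits e.
Proof.
move=> epv pv dv.
have pDv : p != v by apply: contraTneq epv => ->; rewrite eirr.
have del a b : e a b -> a != p -> b != p -> del_rel p v a b.
  by move=> ab ap bp; apply: del_relP => //; [left|right].
have vp a : e a p -> a = v by rewrite esym => /pv.
have dv' : 3 < #|del_rel p v v|.
  have := cardD1 p (e v); rewrite -[p \in e v]/(e v p) esym epv => E.
  rewrite E add1n ltnS in dv; apply: leq_trans dv _.
  apply: subset_leq_card; apply/subsetP => w; rewrite !inE => /andP[wp evw].
  by apply: del; rewrite // eq_sym.
case=> [[P [Pu Pm]]|[[[n B] c] LL [f [/= fi fe]]]]; [left|right].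
  exists P; split=> // x y z xP yP zP xy xz.
  case: (boolP (P v)) => [Pv|vP].
    have xp : x != p by apply: contraNneq yP => xp; rewrite xp in xy; rewrite (pv _ xy).
    have np w : ~~ P w -> e x w -> w != p.
      move=> _ xw; apply: contraNneq xP => wp; rewrite wp in xw.
      by rewrite (vp _ xw).
    by apply: (Pm x) => //; apply: del => //; apply: np.
  (* A vertex other than the hub has at most one neighbour besides the hub. *)
  suff : #|del_rel p v v| <= 2 by rewrite leqNgt ltnW.
  have [Q1|Q2] : (exists q, P q) \/ (forall q, ~~ P q).
  - case: (boolP [exists q, P q]) => [/existsP|/existsPn]; by [left|right].
  - have [q Pq] := Q1.
    rewrite (cardD1 q) -(addn1 1) leq_add ?leq_b1 //.
    apply/card_le1_eqP => a b; rewrite !inE => /andP[aq va] /andP[bq vb].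
    have nP w : w != q -> ~~ P w by apply: contra => Pw; rewrite (Pu _ _ Pw Pq).
    by apply: (Pm v) => //; apply: nP.
  - apply: (@leq_trans 1) => //.
    apply/card_le1_eqP => a b va vb.
    by apply: (Pm v).
exists (n, B, c) => //.
have /allP/(_ _ LL)/and3P[/= wfB _ cn] := Lcodes_wf.
have wfC : wf (n.+1, (c, n) :: B).
  rewrite /wf /= cn ltnSn; apply: sub_all wfB => q /= /andP[-> /ltnW]; exact.
have /card_gt0P[w0 vw0] : 0 < #|del_rel p v v| by apply: leq_trans dv'.
have notK w : del_rel p v v w -> sE ((c, n) :: B) (f v) (f w).
  move=> vw; case: (fe v w vw) => // -[_ _ K].
  suff : #|del_rel p v v| <= 1 by rewrite leqNgt (leq_trans _ dv').
  by apply/card_le1_eqP => a b /K-> /K->.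
have fvn : f v < n.+1 by have /andP[] := sE_lt wfC (notK _ vw0).
have fv : f v = c.
  apply/eqP; have /allP/(_ _ LL)/allP/(_ (f v)) := Lcodes_deg.
  rewrite mem_iota fvn => /(_ isT)/orP[//|/andP[N3 Nn]].
  (* If [v] were not at the centre, its neighbours would have labels below [n], where [f] is
     injective, and at most three labels are adjacent to [f v]. *)
  have inN w : w \in enum (del_rel p v v) -> f w < n /\ f w \in undup (nbrs ((c, n) :: B) (f v)).
    rewrite mem_enum => /notK fvw.
    have fwN : f w \in undup (nbrs ((c, n) :: B) (f v)) by rewrite mem_undup (mem_nbrs _ _ wfC).
    split=> //; have /andP[_] := sE_lt wfC fvw; rewrite ltnS leq_eqVlt => /orP[/eqP fwn|//].
    by move: fwN; rewrite fwn (negPf Nn).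
  have : size (map f (enum (del_rel p v v))) <= 3.
    apply: leq_trans N3; apply: uniq_leq_size => [|i /mapP[w wN ->]]; last by have [] := inN w wN.
    rewrite map_inj_in_uniq ?enum_uniq // => a b aN _ fab.
    by apply: fi => //; have [] := inN a aN.
  by rewrite size_map -cardE leqNgt dv'.
exists (fun x => if x == p then n else f x); split=> /= [x y|x y xy].
  case: (eqVneq x p) => [->|_]; first by rewrite ltnn.
  by case: (eqVneq y p) => [_ ->|_]; [rewrite ltnn | apply: fi].
case: (eqVneq x p) => [xp|xp].
  have -> : y = v by apply: pv; rewrite -xp.
  by rewrite eq_sym (negPf pDv) fv; left; rewrite /sE !inE eqxx orbT.
case: (eqVneq y p) => [yp|yp].
  have -> : x = v by apply: vp; rewrite -yp.
  by rewrite fv; left; rewrite /sE !inE eqxx.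
case: (fe x y (del _ _ xy xp yp)) => [|[fx fy K]]; first by left.
right; split=> // z xz; apply: K; apply: del => //.
apply: contraTneq xz => ->; apply/negP => /vp xv.
by move: fx cn; rewrite xv fv => ->; rewrite ltnNge leqnSn.
Qed.

End Reductions.

Theorem Afree_fits (T : finType) (e : rel T) :
  symmetric e -> irreflexive e -> Afree e -> fits e.
Proof.
have [m] := ubnP #|[pred p : T * T | e p.1 p.2]|.
elim: m e => // m IH e; rewrite ltnS => em esym eirr eA.
have IHdel x y : e x y -> fits (del_rel e x y).
  move=> xy; apply: IH; [exact: leq_trans (card_del_rel xy) em | exact: del_rel_sym
    | exact: del_rel_irr | exact: Afree_sub (@sub_del_rel _ e x y) eA].
case: (boolP [exists x, exists y, e x y &&
    [forall z, (e x z ==> (z == y)) && (e y z ==> (z == x))]]) => [|/existsPn noK2].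
  case/existsP=> x /existsP[y /andP[xy /forallP h]].
  apply: fits_add_K2 xy _ _ (IHdel _ _ xy) => // z ez; have := h z; rewrite ez /=.
    by case/andP=> /eqP.
  by case/andP=> _ /eqP.
case: (boolP [exists v, exists p, [&& 4 < #|e v|, e p v &
    [forall z, e p z ==> (z == v)]]]) => [|/existsPn nopend].
  case/existsP=> v /existsP[p /and3P[dv pv /forallP h]].
  apply: fits_add_pendant pv _ dv (IHdel _ _ pv) => // z pz.
  by have := h z; rewrite pz => /eqP.
case: (boolP [exists v, 4 < #|e v|]) => [/existsP[v dv]|/existsPn deg4].
  (* A $P_3$ with middle vertex [x] avoiding [v]; if there is none, [v] is the hub of a windmill. *)
  case: (boolP [exists x, exists y, exists z,
      [&& x != v, y != v, z != v, y != z, e x y & e x z]]) => [|/existsPn wm].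
    case/existsP=> x /existsP[y /existsP[z /and5P[xv yv zv yz /andP[xy xz]]]].
    case: (star_search esym eirr eA dv _ xv yv zv yz xy xz) => u vu.
    have /existsPn/(_ u) := nopend v; rewrite dv esym vu /= => /forallPn[w].
    by rewrite negb_imply => /andP[uw wv]; exists w.
  left; exists (pred1 v); split=> [x y /eqP-> /eqP->//|x y z /= xv yv zv xy xz].
  apply/eqP; have /existsPn/(_ y)/existsPn/(_ z) := wm x.
  by rewrite xv yv zv xy xz !andbT /= negbK.
have noK u w : e u w -> exists z, (z != w) && e u z || (z != u) && e w z.
  move=> uw; have /existsPn/(_ w) := noK2 u; rewrite uw /= => /forallPn[z].
  rewrite negb_and !negb_imply => h; exists z.
  by rewrite (andbC (z != w)) (andbC (z != u)).
have start : (exists u w z, [&& z != w, e u w & e u z]) -> fits e.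
  case=> u [w [z /and3P[zw uw uz]]].
  apply: (exhaustP esym eirr eA _ noK exhaust_path3 (mem_head _ _)).
    by move=> v; rewrite leqNgt; apply: deg4.
  (* The labels 0, 1, 2 run along the path, so [u] takes the middle position. *)
  exists (nth u [:: w; u; z]); split=> [//|i j|p].
    rewrite !inE => i3 j3 /eqP; rewrite nth_uniq //= ?inE ?negb_or; first by move/eqP.
    rewrite (eq_sym w z) zw !andbT.
    by apply/andP; split; [apply: contraTneq uw => ->|apply: contraTneq uz => ->]; rewrite eirr.
  by rewrite !inE => /orP[] /eqP->; rewrite //= esym.
case: (boolP [exists u, exists w, e u w]) => [/existsP[u /existsP[w uw]]|/existsPn noE].
  apply: start; have [z /orP[/andP[zw uz]|/andP[zu wz]]] := noK u w uw.
    by exists u, w, z; rewrite zw uw.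
  by exists w, u, z; rewrite zu esym uw.
left; exists pred0; split=> // x y z _ _ _ xy.
by have /existsPn/(_ y) := noE x; rewrite xy.
Qed.

(** * Codes of the graphs in A and L *)

#[local] Arguments adj : simpl never.

Lemma adj_symgraph (T : finType) (r : rel T) (x y : symgraph r) :
  adj x y = (x != y) && (r x y || r y x).
Proof. by []. Qed.

Lemma adj_attach_ll (G : sgraph) (v : G) (H : sgraph) (N : pred H) (u w : G) :
  adj (inl u : attach G v H N) (inl w) = adj u w.
Proof.
rewrite adj_symgraph [adj w u]adj_sym orbb andb_idl // => uw.
by apply: contraTneq uw => -[->]; rewrite adj_irr.
Qed.

Lemma adj_attach_rr (G : sgraph) (v : G) (H : sgraph) (N : pred H) (u w : H) :
  adj (inr u : attach G v H N) (inr w) = adj u w.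
Proof.
rewrite adj_symgraph [adj w u]adj_sym orbb andb_idl // => uw.
by apply: contraTneq uw => -[->]; rewrite adj_irr.
Qed.

Lemma adj_attach_lr (G : sgraph) (v : G) (H : sgraph) (N : pred H) (u : G) (w : H) :
  adj (inl u : attach G v H N) (inr w) = (u == v) && N w.
Proof. by rewrite adj_symgraph orbF. Qed.

Lemma adj_attach_rl (G : sgraph) (v : G) (H : sgraph) (N : pred H) (u : G) (w : H) :
  adj (inr w : attach G v H N) (inl u) = (u == v) && N w.
Proof. by rewrite adj_sym adj_attach_lr. Qed.

Definition adj_attach := (adj_attach_ll, adj_attach_rr, adj_attach_lr, adj_attach_rl).

Lemma adj_dunion_ll (G H : sgraph) (u w : G) : adj (inl u : dunion G H) (inl w) = adj u w.
Proof.
rewrite adj_symgraph [adj w u]adj_sym orbb andb_idl // => uw.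
by apply: contraTneq uw => -[->]; rewrite adj_irr.
Qed.

Lemma adj_dunion_rr (G H : sgraph) (u w : H) : adj (inr u : dunion G H) (inr w) = adj u w.
Proof.
rewrite adj_symgraph [adj w u]adj_sym orbb andb_idl // => uw.
by apply: contraTneq uw => -[->]; rewrite adj_irr.
Qed.

Lemma adj_dunion_lr (G H : sgraph) (u : G) (w : H) : adj (inl u : dunion G H) (inr w) = false.
Proof. by []. Qed.

Lemma adj_dunion_rl (G H : sgraph) (u : G) (w : H) : adj (inr w : dunion G H) (inl u) = false.
Proof. by []. Qed.

Definition adj_dunion := (adj_dunion_ll, adj_dunion_rr, adj_dunion_lr, adj_dunion_rl).

Lemma adj_copies k (G : sgraph) (x y : copies k G) :
  adj x y = (x.1 == y.1) && adj x.2 y.2.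
Proof.
rewrite adj_symgraph [y.1 == _]eq_sym [adj y.2 _]adj_sym orbb andb_idl //.
by case/andP=> _; apply: contraTneq => ->; rewrite adj_irr.
Qed.

Lemma adj_complete n (x y : complete n) : adj x y = (x != y).
Proof. by rewrite adj_symgraph andbT. Qed.

(** [phi] is an isomorphism from [G] onto the graph coded by [H]. *)
Definition presents (G : sgraph) (H : code) (phi : G -> nat) : Prop :=
  [/\ wf H, injective phi, forall x, phi x < H.1,
      forall i, i < H.1 -> exists x, phi x = i
    & forall x y, adj x y = sE H.2 (phi x) (phi y)].

Lemma sE_cat E F i j : sE (E ++ F) i j = sE E i j || sE F i j.
Proof. by rewrite /sE !mem_cat orbACA. Qed.

Lemma sE_cons a b E i j :
  sE ((a, b) :: E) i j =
  [|| (i == a) && (j == b), (j == a) && (i == b) | sE E i j].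
Proof. by rewrite /sE !inE !xpair_eqE -!orbA; do !bool_congr. Qed.

Lemma sE_ge H i j : wf H -> (H.1 <= i) || (H.1 <= j) -> sE H.2 i j = false.
Proof.
move=> wfH ij; apply/negP => /(sE_lt wfH); apply/negP.
by rewrite negb_and -!leqNgt.
Qed.

Lemma sE_irr H i : wf H -> sE H.2 i i = false.
Proof.
by move=> wfH; apply/negP => /orP[] /(wfP wfH) /=; rewrite ltnn.
Qed.

(** * Edges of a code built by attachment *)

Section CodeAttach.
Variables (G H : code) (v : nat) (P : pred nat).
Hypotheses (wfG : wf G) (wfH : wf H) (vG : v < G.1).

Lemma mem_shift n E i j :
  ((i, j) \in shift n E) = [&& n <= i, n <= j & (i - n, j - n) \in E].
Proof.
apply/mapP/and3P => [[[a b] abE [-> ->]]|[ni nj ijE]].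
  by rewrite !leq_addr !addKn.
by exists (i - n, j - n); rewrite //= !subnKC.
Qed.

Lemma mem_attach i j : ((i, j) \in (code_attach G v H P).2) =
  [|| (i, j) \in G.2, [&& G.1 <= i, G.1 <= j & (i - G.1, j - G.1) \in H.2]
    | [&& i == v, G.1 <= j, j < G.1 + H.1 & P (j - G.1)]].
Proof.
rewrite !mem_cat mem_shift; congr [|| _, _ | _].
apply/mapP/and4P => [[t]|[/eqP-> nj jn Pj]].
  by rewrite mem_filter mem_iota => /andP[Pt tH] [-> ->]; rewrite eqxx leq_addr addKn ltn_add2l.
exists (j - G.1); last by rewrite subnKC.
by rewrite mem_filter Pj mem_iota add0n ltn_subLR.
Qed.

Lemma wf_attach : wf (code_attach G v H P).
Proof.
apply/allP => -[i j]; rewrite mem_attach => /or3P[ij|/and3P[ni nj ij]|/and4P[/eqP-> nj jn _]] /=.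
- by have /andP[-> /leq_trans] := wfP wfG ij; apply; apply: leq_addr.
- have /andP[/= h1 h2] := wfP wfH ij.
  by move: h1 h2; rewrite ltn_sub2rE // => ->; rewrite ltn_subLR.
- by rewrite (leq_trans vG nj).
Qed.

Lemma sE_attach_ll i j : i < G.1 -> j < G.1 ->
  sE (code_attach G v H P).2 i j = sE G.2 i j.
Proof.
move=> iG jG; rewrite /sE !mem_attach (leqNgt _ i) (leqNgt _ j) iG jG /=.
by rewrite !andbF !orbF.
Qed.

Lemma sE_attach_lr i j : i < G.1 -> j < H.1 ->
  sE (code_attach G v H P).2 i (G.1 + j) = (i == v) && P j.
Proof.
move=> iG jH; rewrite /sE !mem_attach leq_addr ltn_add2l jH addKn.
rewrite [G.1 <= i]leqNgt iG /= !andbF !orbF.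
have := @sE_ge G i (G.1 + j) wfG; rewrite leq_addr orbT => /(_ isT) /norP[/negPf-> /negPf->].
by rewrite !orbF.
Qed.

Lemma sE_attach_rr i j : i < H.1 -> j < H.1 ->
  sE (code_attach G v H P).2 (G.1 + i) (G.1 + j) = sE H.2 i j.
Proof.
move=> iH jH; rewrite /sE !mem_attach !leq_addr !addKn /=.
have := @sE_ge G (G.1 + i) (G.1 + j) wfG; rewrite leq_addr => /(_ isT) /norP[/negPf-> /negPf->].
have ne k : (G.1 + k == v) = false by rewrite gtn_eqF // ltn_addr.
by rewrite !ne /= !orbF.
Qed.

End CodeAttach.

Definition sum_num (A B : Type) (n : nat) (phi : A -> nat) (psi : B -> nat) (x : A + B) :=
  match x with inl u => phi u | inr w => n + psi w end.

(** The relation on the sum is arbitrary so that both [attach] and [dunion] are covered, the latter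
    with the empty predicate [P]. *)
Lemma presents_sum (G H : sgraph) (a b : code) phi psi v P (r : rel (G + H)) :
    presents a phi -> presents b psi -> v < a.1 ->
    (forall u w, adj (inl u : symgraph r) (inl w) = adj u w) ->
    (forall u w, adj (inr u : symgraph r) (inr w) = adj u w) ->
    (forall u w, adj (inl u : symgraph r) (inr w) = (phi u == v) && P (psi w)) ->
  @presents (symgraph r) (code_attach a v b P) (sum_num a.1 phi psi).
Proof.
move=> [wa ia la sa ea] [wb ib lb sb eb] va ll rr lr; split.
- exact: wf_attach.
- move=> [x|x] [y|y] /=.
  + by move/ia->.
  + by move=> h; have := la x; rewrite h ltnNge leq_addr.
  + by move=> h; have := la y; rewrite -h ltnNge leq_addr.
  + by move/addnI/ib->.
- by case=> x /=; [rewrite ltn_addr | rewrite ltn_add2l].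
- move=> i /= iab; case: (ltnP i a.1) => ia1.
    by have [x <-] := sa i ia1; exists (inl x).
  have [|x xi] := sb (i - a.1); first by rewrite ltn_subLR.
  by exists (inr x); rewrite /= xi subnKC.
- case=> x [] y.
  + by rewrite ll ea /= sE_attach_ll.
  + by rewrite lr /= sE_attach_lr.
  + by rewrite adj_sym lr sEC /= sE_attach_lr.
  + by rewrite rr eb /= sE_attach_rr.
Qed.

Lemma presents_attach (G : sgraph) (v : G) (H : sgraph) (N : pred H) a b phi psi P :
    @presents G a phi -> @presents H b psi -> (forall w, N w = P (psi w)) ->
  @presents (attach G v H N) (code_attach a (phi v) b P) (sum_num a.1 phi psi).
Proof.
move=> pa pb NP; have [_ ia la _ _] := pa.
apply: presents_sum pa pb (la v) _ _ _ => u w; rewrite ?adj_attach //.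
by rewrite NP (inj_eq ia).
Qed.

Lemma presents_dunion (G H : sgraph) a b phi psi : 0 < a.1 ->
    @presents G a phi -> @presents H b psi ->
  @presents (dunion G H) (code_union a b) (sum_num a.1 phi psi).
Proof.
move=> a0 pa pb; apply: presents_sum pa pb a0 _ _ _ => u w; rewrite ?adj_dunion //.
by rewrite andbF.
Qed.

Lemma presents_rel n (r : rel nat) :
  @presents (symgraph (fun i j : 'I_n => r i j)) (code_rel n r) val.
Proof.
have mem i j : ((i, j) \in (code_rel n r).2) = [&& i < j, r i j || r j i & j < n].
  rewrite mem_filter /=; case: (ltnP i j) => //= ij; congr (_ && _).
  apply/allpairsP/idP => [[[a b] [/= _ + [_ ->]]]|jn]; first by rewrite mem_iota.
  by exists (i, j); rewrite !mem_iota /= (ltn_trans ij jn) jn.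
split=> [||[]//|i ni|x y].
- by apply/allP => -[i j]; rewrite mem => /and3P[-> _ ->].
- exact: val_inj.
- by exists (Ordinal ni).
rewrite adj_symgraph /sE !mem !ltn_ord !andbT -val_eqE /=.
by case: ltngtP => //= _; rewrite ?orbF // orbC.
Qed.

Lemma presents_pendants (G : sgraph) (v : G) k a phi : @presents G a phi ->
  @presents (pendants G v k) (code_pendants a (phi v) k)
    (sum_num a.1 phi (fun x : 'I_k * 'I_1 => val x.1)).
Proof.
move=> pa; apply: presents_attach => //; split=> // [[i x] [j y]|[i x]|i ik|x y].
- by rewrite (ord1 x) (ord1 y) /= => /val_inj->.
- exact: ltn_ord.
- by exists (Ordinal ik, ord0).
- by rewrite adj_copies adj_complete (ord1 x.2) (ord1 y.2) eqxx andbF.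
Qed.

Lemma presents_append_path (G : sgraph) (v : G) k a phi : @presents G a phi ->
  @presents (append_path G v k) (code_append_path a (phi v) k) (sum_num a.1 phi val).
Proof. by move=> pa; apply: presents_attach => //; apply: presents_rel. Qed.

Lemma presents_append_K3 (G : sgraph) (v : G) a phi : @presents G a phi ->
  @presents (append_K3 G v) (code_append_K3 a (phi v)) (sum_num a.1 phi val).
Proof.
move=> pa; apply: presents_attach => //.
exact: (presents_rel 2 (fun _ _ => true)).
Qed.

Lemma presents_add_edge (G : sgraph) (u v : G) a phi : @presents G a phi -> phi u < phi v ->
  @presents (add_edge G u v) (code_add a (phi u) (phi v)) phi.
Proof.
move=> [wa ia la sa ea] uv; split=> //.
  by rewrite /wf /= all_rcons /= uv la.
have E i j : sE (code_add a (phi u) (phi v)).2 i j =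
    [|| sE a.2 i j, (i == phi u) && (j == phi v) | (j == phi u) && (i == phi v)].
  by rewrite /= -cats1 sE_cat sE_cons /= orbF.
have uv' : u != v by apply: contraTneq uv => ->; rewrite ltnn.
move=> x y; rewrite adj_symgraph E -ea !(inj_eq ia). rewrite [@adj G y x]adj_sym.
case: (eqVneq x y) => [->|_] /=; last by case: (@adj G x y).
rewrite adj_irr; by case: (eqVneq y u) => [->|_] //; rewrite (negPf uv').
Qed.

Lemma presents_del_edge (G : sgraph) (u v : G) a phi : @presents G a phi -> phi u < phi v ->
  @presents (del_edge G u v) (code_del a (phi u) (phi v)) phi.
Proof.
move=> [wa ia la sa ea] uv; split=> //.
  by apply/allP => p; rewrite mem_filter => /andP[_ /(wfP wa)].
have mem i j : ((i, j) \in (code_del a (phi u) (phi v)).2) =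
    ((i, j) != (phi u, phi v)) && ((i, j) \in a.2) by rewrite mem_filter.
have uv' : u != v by apply: contraTneq uv => ->; rewrite ltnn.
have set2 x y : x != y -> ([set x; y] == [set u; v]) =
    (x == u) && (y == v) || (x == v) && (y == u).
  move=> xy; apply/eqP/orP => [E|[] /andP[/eqP-> /eqP->]//]; last by rewrite setUC.
  move: (set21 x y) (set22 x y) xy.
  rewrite E !inE => /orP[] /eqP-> /orP[] /eqP->; rewrite !eqxx //; by [left|right].
move=> x y; rewrite adj_symgraph /sE !mem !xpair_eqE !(inj_eq ia).
rewrite [@adj G y x]adj_sym [[set y; x]]setUC orbb.
case: (eqVneq x y) => [->|xy] /=.
  have := sE_irr (phi y) wa; rewrite /sE => /norP[/negPf-> _].
  by rewrite !andbF.
rewrite set2 // ea /sE.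
case: (boolP ((phi x, phi y) \in a.2)) => [xyE|_].
  have /andP[/= lt_xy _] := wfP wa xyE.
  have /negPf-> : (phi y, phi x) \notin a.2.
    by apply/negP => /(wfP wa) /= /andP[/ltnW]; rewrite leqNgt lt_xy.
  have /negPf-> : ~~ ((x == v) && (y == u)).
    by apply: contraTN lt_xy => /andP[/eqP-> /eqP->]; rewrite -leqNgt ltnW.
  by rewrite !orbF andbT andbF orbF.
case: (boolP ((phi y, phi x) \in a.2)) => [yxE|_]; last by rewrite !andbF.
have /andP[/= lt_yx _] := wfP wa yxE.
have /negPf-> : ~~ ((x == u) && (y == v)).
  by apply: contraTN lt_yx => /andP[/eqP-> /eqP->]; rewrite -leqNgt ltnW.
by rewrite andbF andbT (andbC (y == u)).
Qed.

Lemma presents_bip k l :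
  presents (G := complete_bip k l) (code_bip k l) (sum_num k val val).
Proof.
have [wa ia la sa ea] := presents_rel (k + l) (fun i j => (i < k) && (k <= j)).
have E (x : complete_bip k l) : sum_num k val val x = val (unsplit x) by case: x.
have ui : injective (@unsplit k l) by apply: can_inj unsplitK.
split=> //.
- by move=> x y; rewrite !E => /val_inj/ui.
- by move=> x; rewrite E.
- move=> i /sa[x <-]; exists (split x).
  by rewrite E splitK.
- move=> x y; rewrite !E -ea !adj_symgraph (inj_eq ui); congr (_ && _).
  by case: x y => x [] y; rewrite /= ?ltn_ord ?leq_addr ?(leqNgt k) ?ltn_ord ?ltnNge ?leq_addr.
Qed.

Lemma presents_copies k (G : sgraph) a phi : presents (G := G) a phi ->
  presents (G := copies k G) (code_copies k a) (fun x => x.1 * a.1 + phi x.2).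
Proof.
move=> [wa ia la sa ea].
have num_inj i j x y : x < a.1 -> y < a.1 -> i * a.1 + x = j * a.1 + y -> i = j /\ x = y.
  move=> xa ya E; have a0 : 0 < a.1 by apply: leq_trans xa.
  have ij : i = j by rewrite -[i]addn0 -(divn_small xa) -divnMDl // E divnMDl // divn_small // addn0.
  by split=> //; apply: (@addnI (i * a.1)); rewrite E ij.
have mem i j x y : i < k -> x < a.1 -> y < a.1 ->
    ((i * a.1 + x, j * a.1 + y) \in (code_copies k a).2) = (i == j) && ((x, y) \in a.2).
  move=> ik xa ya; apply/flattenP/andP => [[s /mapP[t _ ->]]|[/eqP<- xy]].
    case/mapP=> -[x' y'] xy' [E1 E2].
    have /andP[/= h1 h2] := wfP wa xy'.
    have [-> ->] := num_inj _ _ _ _ xa (ltn_trans h1 h2) E1.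
    by have [-> ->] := num_inj _ _ _ _ ya h2 E2.
  exists (shift (i * a.1) a.2); first by apply: map_f; rewrite mem_iota.
  by apply/mapP; exists (x, y).
have lt_num (x : 'I_k * G) : x.1 * a.1 + phi x.2 < k * a.1.
  apply: (@leq_trans (x.1.+1 * a.1)); last by rewrite leq_mul2r ltn_ord orbT.
  by rewrite mulSn addnC ltn_add2r.
split.
- apply/allP => p /flattenP[s /mapP[t]]; rewrite mem_iota => /andP[_ tk] -> /mapP[q qa ->].
  have /andP[q1 q2] := wfP wa qa; rewrite /= ltn_add2l q1 /=.
  apply: (@leq_trans (t.+1 * a.1)); last by rewrite leq_mul2r tk orbT.
  by rewrite mulSn addnC ltn_add2r.
- by move=> [i x] [j y] /= /num_inj[] // /val_inj-> /ia->.
- exact: lt_num.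
- move=> i /= ik; have a0 : 0 < a.1 by case: (a.1) ik => //; rewrite muln0.
  have ik' : i %/ a.1 < k by rewrite ltn_divLR.
  have [x xi] := sa _ (ltn_pmod i a0).
  by exists (Ordinal ik', x); rewrite /= xi -divn_eq.
- move=> x y; rewrite adj_copies ea /sE !mem //.
  by rewrite (eq_sym (y.1 : nat)) -andb_orr -val_eqE.
Qed.

(** Listed in the order of [Acodes], so that an index pairs each graph with its code. *)
Definition Agraphs : seq sgraph := [::
  pendants (pendants (complete 3) 'v[3]_0 1) (inr (ord0, ord0)) 2;
  pendants (del_edge (complete 4) 'v[4]_0 'v[4]_1) 'v[4]_0 1;
  pendants (pendants (cycle_graph 4) 'v[4]_0 1) (inl 'v[4]_2) 1;
  complete_bip 2 3;
  path_graph 7;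
  dunion (path_graph 5) (path_graph 3);
  copies 3 (path_graph 3);
  dunion (complete 3) (complete_bip 1 3);
  copies 2 (complete_bip 1 3);
  copies 2 (complete 3);
  dunion (cycle_graph 4) (path_graph 3);
  complete 4;
  cycle_graph 6;
  pendants (pendants (append_path (complete 3) 'v[3]_0 3) (inl 'v[3]_1) 1)
    (inl (inl 'v[3]_2)) 1;
  pendants (add_edge (cycle_graph 5) 'v[5]_1 'v[5]_4) 'v[5]_0 1;
  pendants (pendants (path_graph 3) 'v[3]_0 2) (inl 'v[3]_2) 2].

Lemma Agraphs_presents i : i < 16 ->
  exists phi, presents (G := nth (complete 0) Agraphs i) (nth (0, [::]) Acodes i) phi.
Proof.
pose pK n := presents_rel n (fun _ _ => true).
pose pP n := presents_rel n (fun i j => j == i.+1).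
pose pC n := presents_rel n (fun i j => j == i.+1 %% n).
pose pend G v k a phi := @presents_pendants G v k a phi.
(* Leaves an equality between the assembled code and the entry of [Acodes], which holds by
   computation. *)
have conv H a a' phi : presents (G := H) a phi -> a = a' ->
    exists phi, presents (G := H) a' phi by move=> ? <-; exists phi.
do 16?[case: i => [_|i]] => //.
- by apply: (conv _ _ _ _ (pend _ _ _ _ _ (pend _ _ _ _ _ (pK 3)))).
- by apply: (conv _ _ _ _ (pend _ _ _ _ _ (@presents_del_edge (complete 4) _ _ _ _ (pK 4) _))).
- by apply: (conv _ _ _ _ (pend _ _ _ _ _ (pend _ _ _ _ _ (pC 4)))).
- by apply: (conv _ _ _ _ (presents_bip 2 3)).
- by apply: (conv _ _ _ _ (pP 7)).
- by apply: (conv _ _ _ _ (presents_dunion _ (pP 5) (pP 3))).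
- by apply: (conv _ _ _ _ (presents_copies 3 (pP 3))).
- by apply: (conv _ _ _ _ (presents_dunion _ (pK 3) (presents_bip 1 3))).
- by apply: (conv _ _ _ _ (presents_copies 2 (presents_bip 1 3))).
- by apply: (conv _ _ _ _ (presents_copies 2 (pK 3))).
- by apply: (conv _ _ _ _ (presents_dunion _ (pC 4) (pP 3))).
- by apply: (conv _ _ _ _ (pK 4)).
- by apply: (conv _ _ _ _ (pC 6)).
- by apply: (conv _ _ _ _ (pend _ _ _ _ _ (pend _ _ _ _ _
    (presents_append_path _ _ (pK 3))))).
- by apply: (conv _ _ _ _ (pend _ _ _ _ _ (@presents_add_edge (cycle_graph 5) _ _ _ _ (pC 5) _))).
- by apply: (conv _ _ _ _ (pend _ _ _ _ _ (pend _ _ _ _ _ (pP 3)))).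
Qed.

Lemma in_A_Agraphs i : i < 16 -> in_A (nth (complete 0) Agraphs i).
Proof. by do 16?[case: i => [_|i]] => //; constructor. Qed.

Lemma in_AE H : in_A H -> exists2 i, i < 16 & H = nth (complete 0) Agraphs i.
Proof.
case.
- by exists 1.
- by exists 15.
- by exists 0.
- by exists 2.
- by exists 14.
- by exists 13.
- by exists 6.
- by exists 5.
- by exists 4.
- by exists 12.
- by exists 11.
- by exists 10.
- by exists 9.
- by exists 8.
- by exists 3.
- by exists 7.
Qed.

(** The cluster is collapsed to the single label [n]: [lab] is bijective onto the base vertices, at
    least [k] vertices (the values of [d]) have label [n], and adjacency can be read off the
    labels. *)
Definition clustered (H : sgraph) (lab : H -> nat) (L : code * nat) (k : nat) : Prop :=
  let: (n, B, c) := L in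
  [/\ wf (n, B) && (c < n),
      forall x y, lab x = lab y -> lab x < n -> x = y,
      forall i, i < n -> exists x, lab x = i,
      exists2 d : 'I_k -> H, injective d & forall t, lab (d t) = n
    & forall x, lab x <= n] /\
  forall x y, adj x y = sE ((c, n) :: B) (lab x) (lab y).

Lemma clustered_pendants (G : sgraph) v k a phi : presents (G := G) a phi ->
  clustered (H := pendants G v k)
    (fun x => match x with inl u => phi u | inr _ => a.1 end) (a, phi v) k.
Proof.
case: a => n B [wa /= ia la sa ea]; split; [split|].
- by rewrite wa la.
- move=> [x|x] [y|y]; rewrite ?ltnn //; first by move/ia->.
  by move=> ->; rewrite ltnn.
- by move=> i /sa[x <-]; exists (inl x).
- by exists (fun t => inr (t, ord0)) => // t t' [].
- by case=> // x; apply: ltnW.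
have ne x : (phi x == n) = false by rewrite (ltn_eqF (la x)).
have nv : (n == phi v) = false by rewrite gtn_eqF.
move=> [x|x] [y|y]; rewrite adj_attach sE_cons ?ne ?nv ?eqxx ?andbF ?andbT //=.
- by rewrite (inj_eq ia) (sE_ge wa) ?leqnn ?orbT // orbF.
- by rewrite (inj_eq ia) (sE_ge wa) ?leqnn // orbF.
- by rewrite adj_copies adj_complete (ord1 x.2) (ord1 y.2) eqxx andbF (sE_irr _ wa).
Qed.

Lemma wf_cluster n B c : wf (n, B) && (c < n) -> wf (n.+1, (c, n) :: B).
Proof.
case/andP=> wfB cn; rewrite /wf /= cn ltnSn.
apply: sub_all wfB => q /= /andP[-> /ltnW]; exact.
Qed.

Lemma clustered_dunion (P H : sgraph) p psi L lab k : 0 < p.1 ->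
    presents (G := P) p psi -> clustered (H := H) lab L k ->
  clustered (H := dunion P H) (sum_num p.1 psi lab) (code_union p L.1, p.1 + L.2) k.
Proof.
case: L => [[n B] c] p0 [wp ip lp sp ep] [[wc ic sc [d di dn] ln] ec] /=.
have wf2 := wf_cluster wc; have /andP[wB cn] := wc.
split; [split|].
- by apply/andP; split; [exact: (wf_attach _ wp wB p0) | rewrite ltn_add2l].
- move=> [x|x] [y|y] /=; last by rewrite ltn_add2l => /addnI/ic h /h->.
  + by move/ip->.
  + by move=> h; have := lp x; rewrite h ltnNge leq_addr.
  + by move=> h; have := lp y; rewrite -h ltnNge leq_addr.
- move=> i ipn; case: (ltnP i p.1) => [/sp[x <-]|pi]; first by exists (inl x).
  have [|x xi] := sc (i - p.1); first by rewrite ltn_subLR.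
  by exists (inr x); rewrite /= xi subnKC.
- by exists (inr \o d) => [t t' [/di]|t] //=; rewrite dn.
- by case=> x /=; [rewrite (leq_trans (ltnW (lp x))) ?leq_addr | rewrite leq_add2l].
have E i j : sE ((p.1 + c, p.1 + n) :: (code_union p (n, B)).2) i j =
    sE (code_attach p 0 (n.+1, (c, n) :: B) pred0).2 i j.
  rewrite /code_union /code_attach; cbn [fst snd].
  rewrite !filter_pred0 !cats0 sE_cons !sE_cat [shift _ (_ :: _)]/= sE_cons.
  by do !bool_congr.
move=> x y; rewrite E; case: x y => x [] y; rewrite adj_dunion /sum_num.
- by rewrite sE_attach_ll.
- by rewrite sE_attach_lr ?andbF ?ltnS.
- by rewrite sEC sE_attach_lr ?andbF ?ltnS.
- by rewrite sE_attach_rr ?ltnS.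
Qed.

(** For families where single pendant vertices are added after the cluster. The new vertex becomes a
    base vertex with label [n], and [bump] moves the cluster label up to [n.+1]. *)
Lemma clustered_pendant (H : sgraph) lab L k w : clustered (H := H) lab L k ->
    lab w < L.1.1 ->
  clustered (H := pendants H w 1)
    (fun x => match x with inl u => bump L.1.1 (lab u) | inr _ => L.1.1 end)
    (code_pendants L.1 (lab w) 1, L.2) k.
Proof.
case: L => [[n B] c] [[wc ic sc [d di dn] ln] ec] /= wn.
have /andP[wB cn] := wc.
have bs i : i < n -> bump n i = i by move=> h; rewrite /bump leqNgt h.
have bn : bump n n = n.+1 by rewrite /bump leqnn.
split; [split|].
- by apply/andP; split; [exact: (@wf_pendants (n, B) _ 1) | rewrite addn1 ltnS ltnW].
- move=> [x|x] [y|y] /=; rewrite addn1.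
  + move/(can_inj (bumpK n))=> xy xn; congr inl; apply: ic => //.
    by move: xn; have := ln x; rewrite leq_eqVlt => /orP[/eqP->|//]; rewrite bn ltnn.
  + by move/eqP; rewrite eq_sym (negPf (neq_bump _ _)).
  + by move/eqP; rewrite (negPf (neq_bump _ _)).
  + by move: x y => [x x'] [y y']; rewrite (ord1 x) (ord1 x') (ord1 y) (ord1 y').
- move=> i; rewrite addn1 ltnS leq_eqVlt => /orP[/eqP->|iN].
    by exists (inr (ord0, ord0)).
  by have [x xi] := sc i iN; exists (inl x); rewrite xi bs.
- by exists (inl \o d) => [t t' [/di]|t] //=; rewrite dn bn addn1.
- case=> x /=; rewrite addn1 //.
  by have := ln x; rewrite leq_eqVlt => /orP[/eqP->|xn]; rewrite ?bn // bs // ltnW // ltnW.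
rewrite addn1 addn0.
have nw : (n.+1 == lab w) = false by rewrite gtn_eqF // ltnW.
have nc : (n == c) = false by rewrite gtn_eqF.
have n1 : (n == n.+1) = false by rewrite ltn_eqF.
have nB i j : (n <= i) || (n <= j) -> sE B i j = false by apply: (@sE_ge (n, B)).
move=> [x|x] [y|y]; rewrite adj_attach sE_cons sE_cat sE_cons /=.
- rewrite ec sE_cons; have E i : i <= n -> (bump n i == c) = (i == c) /\ (bump n i == n.+1) = (i == n).
    rewrite leq_eqVlt => /orP[/eqP->|iN].
      by rewrite bn !eqxx nc gtn_eqF // ltnW.
    by rewrite bs // (ltn_eqF iN) [i == n.+1]ltn_eqF // ltnS ltnW.
  have [-> ->] := E _ (ln x); have [-> ->] := E _ (ln y).
  rewrite ![bump n _ == n]eq_sym !(negPf (neq_bump _ _)) !andbF !orbF; congr [|| _, _ | _].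
  have := ln x; rewrite leq_eqVlt => /orP[/eqP->|xn].
    by rewrite bn !nB ?leqnn ?leqnSn.
  have := ln y; rewrite leq_eqVlt => /orP[/eqP->|yn]; last by rewrite !bs.
  by rewrite bn !nB ?leqnn ?leqnSn ?orbT.
- rewrite n1 nc nB ?leqnn ?orbT // eqxx (gtn_eqF wn) ?andbF ?andbT ?orbF /=.
  have := ln x; rewrite leq_eqVlt => /orP[/eqP xn|xn].
    by rewrite xn bn nw; apply: contraTF wn => /eqP <-; rewrite xn ltnn.
  by rewrite bs //; apply/eqP/eqP => [->//|/ic]; apply.
- rewrite n1 nc nB ?leqnn // eqxx (gtn_eqF wn) ?andbF ?andbT ?orbF /=.
  have := ln y; rewrite leq_eqVlt => /orP[/eqP xn|xn].
    by rewrite xn bn nw; apply: contraTF wn => /eqP <-; rewrite xn ltnn.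
  by rewrite bs //; apply/eqP/eqP => [->//|/ic]; apply.
- rewrite adj_copies adj_complete (ord1 x.2) (ord1 y.2) eqxx andbF.
  by rewrite nc nB ?leqnn // (gtn_eqF wn).
Qed.

(** In the order of [Lcodes]; the windmills of [L5] are treated through [fit_windmill] instead. *)
Definition Lgraphs (k : nat) : seq sgraph := [::
  pendants (add_edge (cycle_graph 5) 'v[5]_1 'v[5]_4) 'v[5]_1 k;
  pendants (append_path (add_edge (cycle_graph 4) 'v[4]_0 'v[4]_2) 'v[4]_0 3)
    (inl 'v[4]_0) k;
  pendants (append_K3 (cycle_graph 4) 'v[4]_0) (inl 'v[4]_0) k;
  pendants (append_path (complete 3) 'v[3]_0 4) (inl 'v[3]_0) k;
  pendants (pendants (append_path (complete 3) 'v[3]_0 3) (inl 'v[3]_0) k)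
    (inl (inl 'v[3]_1)) 1;
  pendants (append_path (complete 3) 'v[3]_0 3) (inl 'v[3]_1) k;
  pendants (pendants (pendants (complete 3) 'v[3]_0 k) (inl 'v[3]_1) 1)
    (inl (inl 'v[3]_2)) 1;
  pendants (pendants (path_graph 6) 'v[6]_2 k) (inl 'v[6]_3) 1;
  dunion (path_graph 4) (pendants (complete 3) 'v[3]_0 k);
  dunion (path_graph 4) (pendants (path_graph 4) 'v[4]_1 k)].

Lemma Lgraphs_clustered k i : i < 10 ->
  exists lab, clustered (H := nth (complete 0) (Lgraphs k) i) lab
                        (nth ((0, [::]), 0) Lcodes i) k.
Proof.
pose pK n := presents_rel n (fun _ _ => true).
pose pP n := presents_rel n (fun i j => j == i.+1).
pose pC n := presents_rel n (fun i j => j == i.+1 %% n).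
pose clus G v a phi := @clustered_pendants G v k a phi.
have conv H lab L L' : clustered (H := H) lab L k -> L = L' ->
    exists lab, clustered (H := H) lab L' k by move=> ? <-; exists lab.
case: i => [|[|[|[|[|[|[|[|[|[|//]]]]]]]]]] _.
- by apply: (conv _ _ _ _ (clus _ _ _ _ (@presents_add_edge (cycle_graph 5) 'v[5]_1 'v[5]_4 _ _ (pC 5) isT))).
- by apply: (conv _ _ _ _ (clus _ _ _ _ (presents_append_path _ _
    (@presents_add_edge (cycle_graph 4) 'v[4]_0 'v[4]_2 _ _ (pC 4) isT)))).
- by apply: (conv _ _ _ _ (clus _ _ _ _ (presents_append_K3 _ (pC 4)))).
- by apply: (conv _ _ _ _ (clus _ _ _ _ (presents_append_path _ _ (pK 3)))).
- by apply: (conv _ _ _ _ (@clustered_pendant _ _ _ _ _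
    (clus _ _ _ _ (presents_append_path _ _ (pK 3))) _)).
- by apply: (conv _ _ _ _ (clus _ _ _ _ (presents_append_path _ _ (pK 3)))).
- by apply: (conv _ _ _ _ (@clustered_pendant _ _ _ _ _ (@clustered_pendant _ _ _ _ _
    (clus _ _ _ _ (pK 3)) _) _)).
- by apply: (conv _ _ _ _ (@clustered_pendant _ _ _ _ _ (clus _ _ _ _ (pP 6)) _)).
- by apply: (conv _ _ _ _ (@clustered_dunion _ _ _ _ _ _ _ _ (pP 4) (clus _ _ _ _ (pK 3)))).
- by apply: (conv _ _ _ _ (@clustered_dunion _ _ _ _ _ _ _ _ (pP 4) (clus _ _ _ _ (pP 4)))).
Qed.

Lemma in_L0_Lgraphs k i : i < 10 -> in_L0 (nth (complete 0) (Lgraphs k) i).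
Proof. by case: i => [|[|[|[|[|[|[|[|[|[|//]]]]]]]]]] _; constructor. Qed.

Lemma in_L0E H : in_L0 H ->
  (exists t k, H = pendants (windmill t) (inl ord0) k) \/
  exists k i, i < 10 /\ H = nth (complete 0) (Lgraphs k) i.
Proof.
case=> [k|k|k|k|t k _|k|k|k|k|k|k].
5: by left; exists t, k.
all: right; exists k.
- by exists 0.
- by exists 1.
- by exists 2.
- by exists 3.
- by exists 4.
- by exists 5.
- by exists 6.
- by exists 7.
- by exists 8.
- by exists 9.
Qed.

(** * Fitting graphs and members of L *)

Section Pairing.
Variables (T : finType) (e : rel T) (Q : pred T).
Hypotheses (esym : symmetric e) (eirr : irreflexive e).
Hypothesis Q_mate : forall x y z, Q x -> Q y -> Q z -> e x y -> e x z -> y = z.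

(** The edges inside [Q] form a matching. Both ends of such an edge go to the copy of $K_2$ indexed
    by the smaller rank; an unmatched vertex occupies position 0 of its own copy. *)
Definition pairing (x : T) : 'I_#|T| * 'I_2 :=
  if [pick y | Q y && e x y] is Some y then
    if enum_rank y < enum_rank x then (enum_rank y, ord_max)
    else (enum_rank x, ord0)
  else (enum_rank x, ord0).

Lemma pairing_inj x y : Q x -> Q y -> pairing x = pairing y -> x = y.
Proof.
move=> Qx Qy; rewrite /pairing.
case: pickP => [a /andP[Qa xa]|_]; case: pickP => [b /andP[Qb yb]|_];
  do ?case: ifP => _ //; case=> /enum_rank_inj // ab.
by move: xa yb; rewrite -ab esym [e y _]esym; apply: Q_mate.
Qed.

Lemma pairing_adj x y : Q x -> Q y -> e x y ->
  ((pairing x).1 == (pairing y).1) && ((pairing x).2 != (pairing y).2).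
Proof.
move=> Qx Qy exy; have eyx : e y x by rewrite esym.
have mate u v : Q u -> Q v -> e u v -> [pick w | Q w && e u w] = Some v.
  move=> Qu Qv uv; case: pickP => [w /andP[Qw uw]|/(_ v)]; last by rewrite Qv uv.
  by rewrite (Q_mate Qu Qw Qv uw uv).
rewrite /pairing (mate x y) // (mate y x) //.
case: (ltngtP (enum_rank x) (enum_rank y)) => [||/val_inj/enum_rank_inj xy] /=; rewrite ?eqxx //.
by rewrite xy eirr in exy.
Qed.

End Pairing.

Lemma copies_K2_mate m (x y z : copies m (complete 2)) :
  adj x y -> adj x z -> y = z.
Proof.
rewrite !adj_copies !adj_complete; case: x y z => [i a] [j b] [k c] /=.
move=> /andP[/eqP<- ab] /andP[/eqP<- ac]; congr pair; apply: val_inj.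
move: ab ac; rewrite -!val_eqE /=.
by case: a b c => [[|[|a]] ?] [[|[|b]] ?] [[|[|c]] ?].
Qed.

Lemma windmill_mate t k m (x y z : dunion (pendants (windmill t) (inl ord0) k)
                                          (copies m (complete 2))) :
  let o := inl (inl (inl ord0)) in
  x != o -> y != o -> z != o -> adj x y -> adj x z -> y = z.
Proof.
have ctr (a : 'I_1) : (inl (inl (inl a)) : dunion (pendants (windmill t) (inl ord0) k)
    (copies m (complete 2))) = inl (inl (inl ord0)) by rewrite (ord1 a).
case: x => [[[a|a]|a]|a]; case: y => [[[b|b]|b]|b]; case: z => [[[c|c]|c]|c];
  rewrite /= ?ctr ?eqxx // => _ _ _; rewrite ?adj_dunion ?adj_attach //=.
- by move=> /copies_K2_mate h /h->.
- by rewrite adj_copies adj_complete (ord1 a.2) (ord1 b.2) eqxx andbF.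
- by move=> /copies_K2_mate h /h->.
Qed.

(** Pull back the hub, or the labels, along the embedding; the added $K_2$ components get the label
    [n.+1]. *)
Lemma in_L_fits (G : sgraph) H : in_L H -> subgraph G H -> fits (@adj G).
Proof.
case=> {}H m LH [g gi ge]; case: (in_L0E LH) => [[t [k HE]]|[k [i [i10 HE]]]]; subst H.
  left; exists (fun x => g x == inl (inl (inl ord0))).
  split=> [x y /eqP gx /eqP gy|x y z xo yo zo xy xz]; first by apply: gi; rewrite gx.
  by apply: gi; apply: (windmill_mate xo yo zo); apply: ge.
right; exists (nth ((0, [::]), 0) Lcodes i); first by rewrite mem_nth.
have [lab] := Lgraphs_clustered k i10.
case: (nth ((0, [::]), 0) Lcodes i) => [[n B] c] [[wc ic _ _ ln] ec].
exists (fun x => match g x with inl h => lab h | inr _ => n.+1 end); split=> /= x y.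
  case gx: (g x) => [h|h]; case gy: (g y) => [h'|h'] //.
  - by move=> hh' /(ic _ _ hh') E; apply: gi; rewrite gx gy E.
  - by move=> ->; rewrite ltnNge leqnSn.
  - by rewrite ltnNge leqnSn.
  - by rewrite ltnNge leqnSn.
move=> xy; have := ge _ _ xy.
case gx: (g x) => [h|h]; case gy: (g y) => [h'|h']; rewrite adj_dunion //.
  by rewrite ec; left.
move=> hh'; right; split=> // z /ge; rewrite gx; case gz: (g z) => [u|u]; rewrite adj_dunion // => hu.
by apply: gi; rewrite gy gz (copies_K2_mate hu hh').
Qed.

Lemma fits_in_L (G : sgraph) : fits (@adj G) -> exists2 H, in_L H & subgraph G H.
Proof.
have asym := @adj_sym G; have airr := @adj_irr G.
case=> [[P [Pu Pm]]|[L LL [f [fi fe]]]].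
  (* There is a triangle for every index used by [pairing], and one more keeps the number positive
     for an empty graph. *)
  exists (dunion (pendants (windmill #|G|.+1) (inl ord0) 0) (copies 0 (complete 2))).
    by constructor; constructor.
  pose p := pairing (@adj G) (predC P).
  exists (fun x => inl (inl (if P x then inl ord0
                             else inr (widen_ord (leqnSn _) (p x).1, (p x).2)))).
    move=> x y; case: ifPn => Px; case: ifPn => Py //; first by move=> _; apply: Pu.
    case=> /val_inj p1 p2; apply: (pairing_inj asym Pm Px Py).
    by rewrite -/p [p x]surjective_pairing [p y]surjective_pairing p1 p2.
  move=> x y xy; rewrite adj_dunion adj_attach.
  case: ifPn => Px; case: ifPn => Py; rewrite adj_attach //.
    by rewrite (Pu x y Px Py) airr in xy.
  rewrite adj_copies adj_complete /=.
  by have := pairing_adj asym airr Pm Px Py xy.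
have [i i10 LE] : exists2 i, i < 10 & nth ((0, [::]), 0) Lcodes i = L.
  by exists (index L Lcodes); rewrite ?nth_index // -[10]/(size Lcodes) index_mem.
have [lab] := Lgraphs_clustered #|G| i10; rewrite LE {LE}.
have LH := in_L0_Lgraphs #|G| i10; move: (nth _ _ _) LH lab => H LH lab.
case: L LL fi fe => [[n B] c] LL /= fi fe [[wc ic sc [d di dn] ln] ec].
have wf2 := wf_cluster wc.
pose Q x := n < f x; pose p := pairing (@adj G) Q.
have Qm x y z : Q x -> Q y -> Q z -> adj x y -> adj x z -> y = z.
  move=> Qx _ _ xy; case: (fe x y xy) => [/(sE_lt wf2)/andP[fxn _]|[_ _ K] /K-> //].
  by move: Qx; rewrite /Q ltnNge -ltnS fxn.
(* Labels below [n] determine the image, vertices of the cluster are separated by their ranks, and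
   the rest is matched by [pairing]. *)
pose spec x (u : dunion H (copies #|G| (complete 2))) := match u with
  | inl h => lab h = f x /\ (f x = n -> h = d (enum_rank x))
  | inr q => n < f x /\ q = p x end.
have [g gP] : exists g : G -> dunion H (copies #|G| (complete 2)), forall x, spec x (g x).
  apply: (fin_all_exists (P := spec)) => x; case: (ltngtP (f x) n) => [/[dup]fx/sc[h hx]|fx|fx].
  - by exists (inl h); split=> // fxn; rewrite fxn ltnn in fx.
  - by exists (inr (p x)).
  - by exists (inl (d (enum_rank x))); split; rewrite ?dn.
exists (dunion H (copies #|G| (complete 2))); first by constructor.
exists g => x y; have := gP x; have := gP y; case: (g x) (g y) => [h|q] [h'|q'] //=.
- move=> [hy dy] [hx dx] [E]; case: (ltngtP (f x) n) => [fxn|fxn|fxn].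
  + by apply: fi fxn; rewrite -hx -hy E.
  + by have := ln h; rewrite hx leqNgt fxn.
  + have fyn : f y = n by rewrite -hy -E hx.
    by move: E; rewrite dx // dy // => /di/enum_rank_inj.
- by move=> [Qy ->] [Qx ->] [E]; apply: (pairing_inj asym Qm Qx Qy).
- move=> [hy _] [hx _] xy; rewrite adj_dunion ec hx hy; case: (fe x y xy) => // -[fx _ _].
  by have := ln h; rewrite hx fx ltnn.
- move=> [fy _] [hx _] xy; case: (fe x y xy) => [/(sE_lt wf2)/andP[_]|[fx _ _]].
    by rewrite /= ltnS leqNgt fy.
  by have := ln h; rewrite hx fx ltnn.
- move=> [hy _] [fx _] xy; case: (fe x y xy) => [/(sE_lt wf2)/andP[]|[_ fy' _]].
    by rewrite /= ltnS leqNgt fx.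
  by have := ln h'; rewrite hy fy' ltnn.
- move=> [Qy ->] [Qx ->] xy; rewrite adj_dunion adj_copies adj_complete.
  exact: pairing_adj.
Qed.

(** * Colourings of line graphs *)

(* The elements of [done] have already been put into the classes indicated
   there, and k classes are in use. *)
Fixpoint minparts (E : Type) (r : rel E) (done : seq (E * nat)) (k : nat) (X : seq E) : nat :=
  if X is e :: X' then
    foldr (fun i m => minn m (minparts r ((e, i) :: done) k X'))
      (minparts r ((e, k) :: done) k.+1 X')
      [seq i <- iota 0 k | all (fun p => (p.2 == i) ==> r e p.1) done]
  else k.

Lemma foldr_minn_le (F : nat -> nat) x0 s :
  let m := foldr (fun i m => minn m (F i)) x0 s in
  m <= x0 /\ forall i, i \in s -> m <= F i.
Proof.
elim: s => [|j s [IH0 IH]] /=; first by split.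
split=> [|i]; first by rewrite geq_min IH0.
by rewrite inE => /orP[/eqP->|/IH h]; rewrite geq_min ?leqnn ?h ?orbT.
Qed.

Lemma foldr_minn_attained (F : nat -> nat) x0 s :
  let m := foldr (fun i m => minn m (F i)) x0 s in
  m = x0 \/ exists2 i, i \in s & m = F i.
Proof.
elim: s => [|j s IH] /=; first by left.
rewrite {1 3}/minn; case: ifP => _; last by right; exists j; rewrite ?mem_head.
case: IH => [|[i is_ E]]; [by left|right; exists i => //].
by rewrite inE is_ orbT.
Qed.

(** Following the classification [c] through the recursion gives one of the partitions over which
    the minimum is taken. *)
Lemma minparts_le (E C : eqType) (r : rel E) (c : E -> C) (s : seq C) X :
    uniq X -> (forall e, e \in X -> c e \in s) ->
    (forall e f, e \in X -> f \in X -> e != f -> c e = c f -> r e f) ->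
  minparts r [::] 0 X <= size s.
Proof.
move=> uX Xs Xr.
(* [U] lists the classes met so far in order of first use; the position in [U] is the number
   recorded in [D]. *)
have : forall X' D U, X =i X' ++ map fst D -> uniq (X' ++ map fst D) ->
    uniq U -> {subset U <= s} ->
    (forall p, p \in D -> c p.1 \in U /\ p.2 = index (c p.1) U) ->
    minparts r D (size U) X' <= size s.
  elim=> [|e X' IH] D U XE uXD uU Us UD /=; first exact: uniq_leq_size.
  have eX : e \in X by rewrite XE mem_head.
  have perm i : X' ++ map fst ((e, i) :: D) =i (e :: X') ++ map fst D.
    by move=> x; rewrite !(mem_cat, inE) orbCA orbA.
  have uX' i : uniq (X' ++ map fst ((e, i) :: D)).
    by rewrite -(perm_uniq (s1 := e :: X' ++ map fst D)) // -cat1s perm_catCA.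
  have [m0 mi] := foldr_minn_le (fun i => minparts r ((e, i) :: D) (size U) X')
    (minparts r ((e, size U) :: D) (size U).+1 X')
    [seq i <- iota 0 (size U) | all (fun p => (p.2 == i) ==> r e p.1) D].
  case: (boolP (c e \in U)) => ceU.
    apply: (leq_trans (mi (index (c e) U) _)).
      rewrite mem_filter mem_iota add0n index_mem ceU !andbT.
      apply/allP => p pD; apply/implyP => /eqP pi.
      have pX : p.1 \in X by rewrite XE mem_cat map_f ?orbT.
      have ep : e != p.1.
        apply: contraTneq uXD => ->; rewrite /= mem_cat map_f //.
        by rewrite orbT.
      apply: Xr => //; have [pU pE] := UD _ pD.
      by rewrite -(nth_index (c e) ceU) -pi pE nth_index.
    apply: IH => // [x|p]; first by rewrite XE perm.
    by rewrite inE => /orP[/eqP->|/UD].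
  apply: (leq_trans m0); rewrite -(size_rcons U (c e)); apply: IH => //.
  - by move=> x; rewrite XE perm.
  - by rewrite rcons_uniq ceU.
  - by move=> x; rewrite mem_rcons inE => /orP[/eqP->|/Us//]; apply: Xs.
  - move=> p; rewrite mem_rcons inE -cats1 index_cat => pD.
    move: pD; rewrite inE => /orP[/eqP-> /=|/UD[-> ->]]; last by rewrite orbT.
    by rewrite eqxx (negPf ceU) /= ?eqxx addn0.
by move=> /(_ X [::] [::]); rewrite cats0; apply.
Qed.

Lemma minparts_attained (E : eqType) (r : rel E) X : symmetric r -> uniq X ->
  exists c : E -> nat, (forall e, e \in X -> c e < minparts r [::] 0 X) /\
    forall e f, e \in X -> f \in X -> e != f -> c e = c f -> r e f.
Proof.
move=> rsym uX.
have : forall X' D k, uniq (X' ++ map fst D) -> (forall p, p \in D -> p.2 < k) ->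
    exists c : E -> nat, [/\ forall p, p \in D -> c p.1 = p.2,
      k <= minparts r D k X', forall e, e \in X' -> c e < minparts r D k X'
      & forall e f, e \in X' -> f \in X' ++ map fst D -> e != f -> c e = c f -> r e f].
  elim=> [|e X' IH] D k uXD Dk.
    elim: D uXD {Dk} => [|[x i] D IH] /=; first by exists (fun=> 0).
    move=> /andP[xD /IH[c [cD _ _ _]]]; exists (fun y => if y == x then i else c y).
    split=> // p; rewrite inE => /orP[/eqP->|pD] /=; first by rewrite eqxx.
    case: eqP => [px|_]; last exact: cD.
    by case/negP: xD; rewrite -px; apply: map_f.
  have uX' i : uniq (X' ++ map fst ((e, i) :: D)).
    by rewrite -(perm_uniq (s1 := e :: X' ++ map fst D)) // -cat1s perm_catCA.
  (* Covers old and new classes alike: [i] is the class chosen for [e] and [k'] the number of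
     classes afterwards. *)
  have step i k' : i < k' -> k <= k' -> (forall p, p \in D -> p.2 = i -> r e p.1) ->
      minparts r D k (e :: X') = minparts r ((e, i) :: D) k' X' ->
      exists c : E -> nat, [/\ forall p, p \in D -> c p.1 = p.2,
        k <= minparts r D k (e :: X'),
        forall x, x \in e :: X' -> c x < minparts r D k (e :: X')
        & forall x y, x \in e :: X' -> y \in (e :: X') ++ map fst D -> x != y -> c x = c y -> r x y].
    move=> ik kk' ri ->; have [p|c [cD kc cX cr]] := IH ((e, i) :: D) k' (uX' i).
      by rewrite inE => /orP[/eqP->//|/Dk h]; apply: leq_trans kk'.
    have ce : c e = i by apply: (cD (e, i)); rewrite mem_head.
    have mem y : y \in (e :: X') ++ map fst D -> y \in X' ++ map fst ((e, i) :: D).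
      by rewrite !(mem_cat, inE) orbCA orbA.
    exists c; split.
    - by move=> p pD; apply: cD; rewrite inE pD orbT.
    - exact: leq_trans kc.
    - by move=> x; rewrite inE => /orP[/eqP->|/cX//]; rewrite ce (leq_trans ik).
    - move=> x y; rewrite inE => /orP[/eqP-> yXD ey exy|xX yXD]; last exact: cr (mem _ yXD).
      move: yXD; rewrite /= inE eq_sym (negPf ey) /= mem_cat => /orP[yX|/mapP[p pD yp]].
        rewrite rsym; apply: cr => //; last by rewrite eq_sym.
        by apply: mem; rewrite /= mem_head.
      by rewrite yp; apply: ri => //; rewrite -ce exy yp; apply/esym/cD; rewrite inE pD orbT.
  have [m0|[i]] := foldr_minn_attained (fun i => minparts r ((e, i) :: D) k X')
    (minparts r ((e, k) :: D) k.+1 X')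
    [seq i <- iota 0 k | all (fun p => (p.2 == i) ==> r e p.1) D].
    by apply: step m0 => // p /Dk + pk; rewrite pk ltnn.
  rewrite mem_filter mem_iota => /andP[/allP Di ik] mi; apply: step mi => // p pD pi.
  by have := Di p pD; rewrite pi eqxx.
case/(_ X [::] 0); rewrite ?cats0 // => c [_ _ c1 c2].
by exists c; split=> // e f eX fX; apply: c2; rewrite ?cats0.
Qed.

(** Pairwise sharing edges form a star or a triangle. Hence [minparts] with [share] is the clique
    cover number of the line graph, and with [nshare] its chromatic number. *)
Definition share (V : eqType) (p q : V * V) : bool :=
  [|| p.1 == q.1, p.1 == q.2, p.2 == q.1 | p.2 == q.2].

Definition nshare (V : eqType) (p q : V * V) : bool := ~~ share p q.

Lemma share_sym (V : eqType) : symmetric (@share V).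
Proof.
by move=> p q; rewrite /share ![q.1 == _]eq_sym ![q.2 == _]eq_sym; do !bool_congr.
Qed.

Lemma Acodes_not_hng : all (fun a => [&& 0 < a.1, uniq a.2 &
  minparts (@nshare _) [::] 0 a.2 + minparts (@share _) [::] 0 a.2 < size a.2]) Acodes.
Proof. by vm_compute. Qed.

Fixpoint subseqs (V : Type) (s : seq V) : seq (seq V) :=
  if s is x :: s' then let t := subseqs s' in t ++ map (cons x) t else [:: [::]].

Lemma filter_subseqs (V : eqType) (p : pred V) s : filter p s \in subseqs s.
Proof.
elim: s => //= x s IH; rewrite mem_cat; case: ifP => _; last by rewrite IH.
by rewrite map_f ?orbT.
Qed.

(** The edge [(c, n)] stands for all pendant edges of the cluster. When it is present, the number of
    colours is replaced by the degree of [c], since this lower bound grows with each further pendant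
    edge. *)
Lemma Lcodes_hng : all (fun L => let: (n, B, c) := L in
  all (fun W => size W <=
      (if (c, n) \in W then count (fun p => (p.1 == c) || (p.2 == c)) W
       else minparts (@nshare _) [::] 0 W) + minparts (@share _) [::] 0 W)
    (subseqs ((c, n) :: B))) Lcodes.
Proof. by vm_compute. Qed.

Lemma chi_colorable (G : sgraph) : colorable G (chi G).
Proof. by rewrite /chi; case: ex_minnP. Qed.

Lemma chi_le (G : sgraph) k : colorable G k -> chi G <= k.
Proof. by rewrite /chi; case: ex_minnP => m _; apply. Qed.

Lemma colorableP (G : sgraph) k :
  reflect (exists f : G -> 'I_k, forall x y, adj x y -> f x != f y) (colorable G k).
Proof.
apply: (iffP existsP) => [[f /forallP h]|[f h]].
  by exists f => x y; have /forallP/(_ y)/implyP := h x.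
exists (finfun f); apply/forallP => x; apply/forallP => y; apply/implyP => xy.
by rewrite !ffunE h.
Qed.

Lemma shareE (T : finType) (p q : T * T) :
  share p q = ([set p.1; p.2] :&: [set q.1; q.2] != set0).
Proof.
apply/idP/set0Pn => [|[z]]; last first.
  rewrite !inE /share => /andP[/orP[] /eqP-> /orP[] ->]; rewrite ?orbT //.
by case/or4P=> /eqP E; [exists p.1|exists p.1|exists p.2|exists p.2];
  rewrite !inE !eqxx ?orbT E eqxx ?orbT.
Qed.

(** * The class 1-HNG expressed through edges of the graph *)

Section LineGraph.
Variable G : sgraph.

(** [f1] is an edge colouring and [f2] a clique cover of a family of edges. The relation [o] fixes
    an orientation of each edge, so that edges can be compared with the ordered pairs of a code. *)
Lemma one_HNG_lineI (o : rel G) : (forall x y, adj x y -> o x y || o y x) ->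
  (forall (I : finType) (pr : I -> G * G) a b (f1 : I -> 'I_a) (f2 : I -> 'I_b),
     (forall i, adj (pr i).1 (pr i).2 && o (pr i).1 (pr i).2) ->
     (forall i j, [set (pr i).1; (pr i).2] = [set (pr j).1; (pr j).2] -> i = j) ->
     (forall i j, f1 i = f1 j -> share (pr i) (pr j) -> i = j) ->
     (forall i j, f2 i = f2 j -> share (pr i) (pr j)) ->
     #|I| <= a + b) ->
  one_HNG (line G).
Proof.
move=> oG h S.
have /colorableP[f1 f1P] := chi_colorable (induced S).
have /colorableP[f2 f2P] := chi_colorable (compl (induced S)).
pose spec (x : induced S) (p : G * G) :=
  val (val x) = [set p.1; p.2] /\ adj p.1 p.2 && o p.1 p.2.
have [pr prP] : exists pr : induced S -> G * G, forall x, spec x (pr x).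
  apply: (fin_all_exists (P := spec)) => x; have := valP (val x).
  case/imset2P=> u w _; rewrite inE => /andP[_ uw] E.
  case/orP: (oG _ _ uw) => ouw; first by exists (u, w); split; rewrite ?uw.
  by exists (w, u); split; rewrite 1?setUC //= adj_sym uw.
have inj i j : [set (pr i).1; (pr i).2] = [set (pr j).1; (pr j).2] -> i = j.
  by have [<- _] := prP i; have [<- _] := prP j; move=> /val_inj/val_inj.
have adjE i j : adj i j = (i != j) && share (pr i) (pr j).
  rewrite shareE; have [<- _] := prP i; have [<- _] := prP j.
  by rewrite -(inj_eq val_inj).
apply: (h _ pr _ _ f1 f2) => [i||i j fij ij|i j fij] //.
- by have [] := prP i.
- apply/eqP; apply: contraLR (ij) => nij; apply/negP => ij'.
  by have := f1P i j; rewrite adjE nij ij' fij eqxx => /(_ isT).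
- case: (eqVneq i j) => [->|nij]; first by rewrite /share eqxx.
  apply: contraT => nsh; have := f2P i j; rewrite fij eqxx.
  by rewrite [adj _ _]/(compl_adj i j) /compl_adj adjE nij (negPf nsh) => /(_ isT).
Qed.

(** The edges of the copy of [a] induce the violating subgraph: optimal partitions of the edge list
    of [a] bound its two chromatic numbers from above. *)
Lemma not_one_HNG_line a s : a \in Acodes -> cont (@adj G) a s -> ~ one_HNG (line G).
Proof.
move=> aA [wa si se] hng.
have /allP/(_ _ aA)/and3P[_ ua lta] := Acodes_not_hng.
pose edge (p : nat * nat) := [set s p.1; s p.2].
pose S := [set x : line G | val x \in map edge a.2].
have lt_a p : p \in a.2 -> p.1 < a.1 /\ p.2 < a.1.
  by move=> /(wfP wa)/andP[h1 h2]; rewrite h2 (ltn_trans h1 h2).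
have s_eq i j : i < a.1 -> j < a.1 -> (s i == s j) = (i == j).
  by move=> ia ja; apply/eqP/eqP => [|->//]; apply: si.
have shE p q : p \in a.2 -> q \in a.2 -> share p q = (edge p :&: edge q != set0).
  move=> /lt_a[p1 p2] /lt_a[q1 q2]; rewrite -(shareE (s p.1, s p.2) (s q.1, s q.2)).
  by rewrite /share /= !s_eq.
have edge_inj : {in a.2 &, injective edge}.
  move=> p q pa qa E; have [p1 p2] := lt_a p pa; have [q1 q2] := lt_a q qa.
  have /andP[lp _] := wfP wa pa; have /andP[lq _] := wfP wa qa.
  have : s p.1 \in edge q by rewrite -E set21.
  have : s p.2 \in edge q by rewrite -E set22.
  rewrite !inE !s_eq // => /orP[] /eqP e2 /orP[] /eqP e1.
  - by rewrite e1 e2 ltnn in lp.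
  - by move: lp; rewrite e1 e2 ltnNge ltnW.
  - by rewrite [p]surjective_pairing [q]surjective_pairing e1 e2.
  - by rewrite e1 e2 ltnn in lp.
have cardS : size a.2 <= #|induced S|.
  rewrite card_sig cardE -(size_map edge) -[size (enum _)](size_map val).
  apply: uniq_leq_size; first by rewrite map_inj_in_uniq.
  move=> x xa; have xe : x \in edges G.
    have /mapP[p pa ->] := xa; apply/imset2P; exists (s p.1) (s p.2); rewrite ?inE //.
    by rewrite se.
  apply/mapP; exists (Sub x xe : line G); last by rewrite SubK.
  by rewrite mem_enum inE SubK.
pose q (x : induced S) := nth (0, 0) a.2 (index (val (val x)) (map edge a.2)).
have qP x : q x \in a.2 /\ edge (q x) = val (val x).
  have xS : val (val x) \in map edge a.2 by have := valP x; rewrite inE.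
  have ix : index (val (val x)) (map edge a.2) < size a.2 by rewrite -(size_map edge) index_mem.
  by rewrite mem_nth // -(nth_map _ set0) // nth_index.
have q_inj x y : q x = q y -> x = y.
  move=> qxy; apply: val_inj; apply: val_inj.
  by have [_ <-] := qP x; have [_ <-] := qP y; rewrite qxy.
have adjE x y : adj x y = (x != y) && share (q x) (q y).
  have [qx Ex] := qP x; have [qy Ey] := qP y.
  by rewrite shE // Ex Ey -(inj_eq val_inj).
(* Applied to the induced line graph and to its complement, which have the same vertices, with [h]
   the identity. *)
have bound (r : rel (nat * nat)) (K : sgraph) (h : K -> induced S) : symmetric r ->
    (forall x y, adj x y -> h x != h y /\ ~~ r (q (h x)) (q (h y))) ->
    chi K <= minparts r [::] 0 a.2.
  move=> rsym hr; have [c [clt cr]] := minparts_attained rsym ua.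
  apply/chi_le/colorableP; exists (fun x => Ordinal (clt _ (proj1 (qP (h x))))).
  move=> x y /hr[hxy nr]; apply: contra nr => /eqP[cxy].
  apply: cr cxy; rewrite ?(proj1 (qP _)) //.
  by apply: contraNneq hxy => /q_inj->.
have := hng S; apply/negP; rewrite -ltnNge; apply: leq_trans cardS.
apply: leq_trans lta; rewrite ltnS leq_add //.
- apply: (bound (@nshare _) (induced S) id) => [p p'|x y]; first by rewrite /nshare share_sym.
  by rewrite adjE /nshare negbK => /andP[].
- apply: (bound (@share _) (compl (induced S)) id) => [|x y]; first exact: share_sym.
  change (@compl_adj (induced S) x y -> id x != id y /\ ~~ share (q x) (q y)).
  rewrite /compl_adj adjE => /andP[xy].
  by rewrite xy.
Qed.

End LineGraph.

(** The ends of [p] have no other neighbours, so an edge meeting [p] is [p] itself. *)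
Lemma share_mate (T : finType) (e : rel T) (p q : T * T) :
    symmetric e -> e p.1 p.2 -> e q.1 q.2 ->
    (forall u v w, u \in [set p.1; p.2] -> e u v -> e u w -> v = w) ->
  share p q -> [set p.1; p.2] = [set q.1; q.2].
Proof.
move=> esym ep eq mate; have ep' := ep; have eq' := eq.
rewrite esym in ep'; rewrite esym in eq'.
case/or4P=> /eqP E.
- by rewrite E (mate p.1 p.2 q.2) ?set21 ?E // -E.
- by rewrite E (mate p.1 p.2 q.1) ?set21 ?E // -?E // setUC.
- by rewrite E (mate p.2 p.1 q.2) ?set22 ?E // -?E // setUC.
- by rewrite E (mate p.2 p.1 q.1) ?set22 ?E // -?E.
Qed.

Lemma card_set_ord k (A : {set 'I_k}) : #|A| <= k.
Proof. by rewrite -[X in _ <= X]card_ord max_card. Qed.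

(** * Counting edges against colours and cliques *)

Section Bounds.
Variables (G : sgraph) (I : finType) (pr : I -> G * G) (a b : nat).
Variables (f1 : I -> 'I_a) (f2 : I -> 'I_b).
Hypothesis pr_adj : forall i, adj (pr i).1 (pr i).2.
Hypothesis pr_inj : forall i j,
  [set (pr i).1; (pr i).2] = [set (pr j).1; (pr j).2] -> i = j.
Hypothesis f1P : forall i j, f1 i = f1 j -> share (pr i) (pr j) -> i = j.
Hypothesis f2P : forall i j, f2 i = f2 j -> share (pr i) (pr j).

Lemma star_bound (A : {set I}) v :
  (forall i, i \in A -> v \in [set (pr i).1; (pr i).2]) -> #|A| <= a.
Proof.
move=> Av; rewrite -(card_in_imset (f := f1)) ?card_set_ord //.
move=> i j iA jA /f1P; apply; rewrite shareE; apply/set0Pn; exists v.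
by rewrite inE !Av.
Qed.

(** Edges at the hub have distinct colours, so there are at most [a] of them. The others form a
    matching and lie in distinct cliques, so there are at most [b]. *)
Lemma fit_windmill_bound : fit_windmill (@adj G) -> #|I| <= a + b.
Proof.
case=> P [Pu Pm]; pose A := [set i | P (pr i).1 || P (pr i).2].
rewrite -(cardsC A) leq_add //.
  case: (set_0Vmem A) => [->|[i iA]]; first by rewrite cards0.
  have [v Pv] : exists v, P v by move: iA; rewrite inE => /orP[]; eexists; eassumption.
  by apply: (star_bound (v := v)) => j; rewrite !inE => /orP[] /(Pu _ _ Pv)->; rewrite eqxx ?orbT.
rewrite -(card_in_imset (f := f2)) ?card_set_ord //.
move=> i j; rewrite !inE => /norP[i1 i2] /norP[j1 j2] /f2P sh; apply: pr_inj.
pose e' u v := [&& adj u v, ~~ P u & ~~ P v].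
apply: (share_mate (e := e')) sh; rewrite /e' ?pr_adj ?i1 ?i2 ?j1 ?j2 //.
  by move=> u v; rewrite adj_sym [~~ P v && _]andbC.
by move=> u v w _ /and3P[uv Pu' Pv] /and3P[uw _ Pw]; apply: (Pm u).
Qed.

(** The edges split into [K] ($K_2$ components), [Pn] (pendant edges of the cluster) and [X] (the
    rest). One edge of [Pn] together with [X] gives a sublist [W] of the code, to which [Lcodes_hng]
    applies; [K] is paid for by extra cliques and the rest of [Pn] by extra colours. *)
Lemma fit_bound n B c (f : G -> nat) : (n, B, c) \in Lcodes ->
    (forall x y, f x = f y -> f x < n -> x = y) ->
    (forall x y, adj x y -> sE ((c, n) :: B) (f x) (f y) \/
       [/\ f x = n.+1, f y = n.+1 & forall z, adj x z -> z = y]) ->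
    (forall i, ((f (pr i).1, f (pr i).2) \in (c, n) :: B) || (n < f (pr i).1)) ->
  #|I| <= a + b.
Proof.
move=> LL fi fe or_pr; pose B' := (c, n) :: B.
pose lab i := (f (pr i).1, f (pr i).2).
have /allP/(_ _ LL)/and3P[/= wfB uB cn] := Lcodes_wf.
have cnB : (c, n) \notin B by apply/negP => /(wfP wfB); rewrite /= ltnn andbF.
have uB' : uniq B' by rewrite /= cnB.
have wfB' : wf (n.+1, B') by rewrite (@wf_cluster n B c) ?wfB.
pose K := [set i | n < f (pr i).1].
pose Pn := [set i | lab i == (c, n)].
pose X := ~: (K :|: Pn).
have lab_B' i : i \notin K -> lab i \in B' by rewrite in_set => /negPf iK; have := or_pr i; rewrite iK orbF.
have lab_le i : i \notin K -> f (pr i).1 <= n /\ f (pr i).2 <= n.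
  by move/lab_B'/(wfP wfB') => /= /andP[h]; rewrite ltnS => h2; rewrite h2 (leq_trans (ltnW h)).
have lab_X i : i \in X -> f (pr i).1 < n /\ f (pr i).2 < n.
  rewrite in_setC in_setU => /norP[/lab_B']; rewrite inE [i \in Pn]inE => /orP[-> //|].
  by move=> /(wfP wfB)/= /andP[h1 h2] _; rewrite h2 (ltn_trans h1).
have PnK i : i \in Pn -> i \notin K by rewrite !inE => /eqP[-> _]; rewrite -leqNgt ltnW.
have K_mate i u v w : i \in K -> u \in [set (pr i).1; (pr i).2] -> adj u v -> adj u w -> v = w.
  rewrite inE => iK ui uv uw; have := pr_adj i.
  have notB x y : n < f x -> sE B' (f x) (f y) = false.
    by move=> h; apply: (sE_ge wfB'); rewrite h.
  move=> /fe[|[_ E2 _]]; first by rewrite notB.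
  have fu : n < f u by move: ui; rewrite !inE => /orP[] /eqP-> //; rewrite E2.
  have m x : adj u x -> forall z, adj u z -> z = x by move=> /fe[|[]]; rewrite ?notB.
  exact: m uw _ uv.
have lab_inj : {in X &, injective lab}.
  move=> i j iX jX [E1 E2]; have [h1 h2] := lab_X i iX.
  by apply: pr_inj; rewrite (fi _ _ E1 h1) (fi _ _ E2 h2).
have share_lab i j : share (pr i) (pr j) -> share (lab i) (lab j).
  by case/or4P=> /eqP E; rewrite /share /= E eqxx ?orbT.
(* [Y] keeps a single representative of the cluster, which makes the labelling of edges
   injective. *)
have [Y [YX YK Yinj YE]] : exists Y : {set I}, [/\ X \subset Y, Y \subset ~: K,
    {in Y &, injective lab}
    & (Pn = set0 /\ Y = X) \/ exists2 i0, i0 \in Pn & Y = i0 |: X].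
  have XK : X \subset ~: K by rewrite setCS subsetUl.
  case: (set_0Vmem Pn) => [P0|[i0 i0P]].
    by exists X; split=> //; left.
  exists (i0 |: X); split; [exact: subsetUr | | | by right; exists i0].
    by rewrite subUset sub1set inE PnK.
  have ne i : i \in X -> lab i <> lab i0.
    move=> /lab_X[_ h] [_ E]; move: i0P; rewrite inE => /eqP[_ E'].
    by rewrite E E' ltnn in h.
  move=> i j; rewrite !in_setU1 => /orP[/eqP->|iX] /orP[/eqP->|jX] //.
  - by move/esym/(ne j jX).
  - by move/(ne i iX).
  - exact: lab_inj.
have YB' i : i \in Y -> lab i \in B' by move/(subsetP YK); rewrite in_setC; apply: lab_B'.
pose W := [seq p <- B' | p \in map lab (enum Y)].
have WY : perm_eq W (map lab (enum Y)).
  apply: uniq_perm => [||p]; first exact: filter_uniq.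
    by rewrite map_inj_in_uniq ?enum_uniq // => i j; rewrite !mem_enum; apply: Yinj.
  rewrite mem_filter andb_idr // => /mapP[i]; rewrite mem_enum => iY ->; exact: YB'.
have sizeW : size W = #|Y| by rewrite (perm_size WY) size_map -cardE.
have uW : uniq W by rewrite filter_uniq.
have parts (C : finType) (g : I -> C) (r : rel (nat * nat)) :
    (forall i j, i \in Y -> j \in Y -> lab i != lab j -> g i = g j -> r (lab i) (lab j)) ->
    minparts r [::] 0 W <= #|g @: Y|.
  move=> gr; pose h (w : nat * nat) := omap g [pick i | (i \in Y) && (lab i == w)].
  have hW w : w \in W -> exists i, [/\ i \in Y, lab i = w & h w = Some (g i)].
    rewrite (perm_mem WY) => /mapP[i]; rewrite mem_enum => iY ->; rewrite /h.
    case: pickP => [j /andP[jY /eqP ij]|/(_ i)]; last by rewrite iY eqxx.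
    by exists j.
  rewrite cardE -(size_map Some); apply: (minparts_le (c := h)) => // [w|w w'] /hW[i [iY iw ->]].
    by rewrite map_f // mem_enum imset_f.
  by move=> /hW[j [jY jw ->]]; rewrite -iw -jw => ij [gij]; apply: gr.
(* Each $K_2$ component has a clique of its own, containing no edge of [Y], so the two numbers of
   classes add up. *)
have theta_le : minparts (@share _) [::] 0 W + #|K| <= b.
  have -> : #|K| = #|f2 @: K|.
    rewrite card_in_imset // => i j iK jK /f2P sh; apply: pr_inj.
    apply: (share_mate (@adj_sym G)) sh; rewrite ?pr_adj // => u v w; exact: K_mate.
  apply: (@leq_trans #|f2 @: Y :|: f2 @: K|); last exact: card_set_ord.
  rewrite cardsU (_ : _ :&: _ = set0) ?cards0 ?subn0 ?leq_add2r.
    by apply: parts => i j _ _ _ /f2P/share_lab.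
  apply/setP => z; rewrite !inE; apply/negP => /andP[/imsetP[i iY ->] /imsetP[j jK /f2P]].
  have /lab_le[h1 h2] : i \notin K by move/(subsetP YK): iY; rewrite in_setC.
  have jK' := jK; rewrite inE in jK'.
  have jK2 : n < f (pr j).2.
    case: (fe _ _ (pr_adj j)) => [/(sE_lt wfB')/andP[] /=|[_ -> _] //].
    by rewrite ltnS leqNgt jK'.
  by case/or4P=> /eqP E; move: h1 h2; rewrite E ![_ <= n]leqNgt ?jK' ?jK2.
have cardI : #|I| = #|Pn| + #|X| + #|K|.
  rewrite -(cardsC (K :|: Pn)) cardsU (_ : K :&: Pn = set0) ?cards0 ?subn0; first by rewrite -addnA addnC.
  by apply/setP => i; rewrite !in_setI in_set0; apply/negP => /andP[iK /PnK]; rewrite iK.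
have /allP/(_ _ LL)/allP/(_ W (filter_subseqs _ _)) := Lcodes_hng.
rewrite sizeW; set mt := minparts (@share _) _ _ _ => check.
(* If [Pn] is empty, all labels are below [n], where [f] is injective, and [f1] induces a proper
   colouring of [W]. *)
rewrite cardI; case: YE => [[P0 YE]|[i0 i0P YE]].
  have ncW : (c, n) \notin W.
    rewrite (perm_mem WY); apply/negP => /mapP[i]; rewrite mem_enum YE => /lab_X[_ h] [_ E].
    by rewrite -E ltnn in h.
  rewrite (negPf ncW) in check; rewrite P0 cards0 add0n -YE.
  apply: leq_trans (leq_add (leqnn a) theta_le); rewrite addnA leq_add2r.
  apply: leq_trans check _; rewrite leq_add2r.
  apply: (@leq_trans #|f1 @: Y|); last exact: card_set_ord.
  apply: parts => i j; rewrite YE => iX jX nij fij; apply/negP => sh.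
  case/eqP: nij; congr lab; apply: f1P fij _.
  have [h1 h2] := lab_X i iX.
  case/or4P: sh => /eqP E; rewrite /share.
  - by rewrite (fi _ _ E h1) eqxx.
  - by rewrite (fi _ _ E h1) eqxx orbT.
  - by rewrite (fi _ _ E h2) eqxx !orbT.
  - by rewrite (fi _ _ E h2) eqxx !orbT.
have li0 : lab i0 = (c, n) by apply/eqP; move: i0P; rewrite inE.
have cW : (c, n) \in W.
  by rewrite (perm_mem WY) -li0 map_f // mem_enum YE setU11.
have i0X : i0 \notin X by rewrite in_setC in_setU i0P orbT.
pose D (p : nat * nat) := (p.1 == c) || (p.2 == c).
pose XD := [set i in X | D (lab i)].
have countW : count D W = #|XD|.+1.
  rewrite (permP WY) count_map -size_filter.
  have -> : size [seq i <- enum Y | preim lab D i] = #|[set i in Y | D (lab i)]|.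
    rewrite cardE; apply/perm_size/uniq_perm => [||i].
    - exact/filter_uniq/enum_uniq.
    - exact: enum_uniq.
    - by rewrite mem_filter mem_enum mem_enum in_set andbC.
  have -> : [set i in Y | D (lab i)] = i0 |: XD; last by rewrite cardsU1 in_set (negPf i0X).
  apply/setP => i; rewrite YE !inE andb_orl; congr (_ || _).
  by case: eqP => //= ->; rewrite li0 /D eqxx.
rewrite cW -/D countW YE cardsU1 i0X add1n addSn ltnS in check.
(* These edges all meet the vertex labelled [c] and so have distinct colours. *)
have star : #|Pn| + #|XD| <= a.
  have -> : #|Pn| + #|XD| = #|Pn :|: XD|.
    rewrite cardsU (_ : _ :&: _ = set0) ?cards0 ?subn0 //.
    apply/setP => i; rewrite !in_setI in_set0; apply/negP => /andP[iP].
    by rewrite inE => /andP[+ _]; rewrite in_setC in_setU iP orbT.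
  apply: (star_bound (v := (pr i0).1)) => i.
  have [fi0 _] := li0.
  have eqc u : f u = c -> u = (pr i0).1 by move=> fu; apply: fi; rewrite fu ?fi0.
  rewrite in_setU => /orP[|]; first by rewrite inE => /eqP[/eqc<- _]; rewrite set21.
  by rewrite inE => /andP[_ /orP[] /eqP/eqc <-]; rewrite ?set21 ?set22.
apply: leq_trans (leq_add star theta_le).
by rewrite -!addnA leq_add2l addnA leq_add2r.
Qed.

End Bounds.

Lemma fits_one_HNG (G : sgraph) : fits (@adj G) -> one_HNG (line G).
Proof.
case=> [wm|[[[n B] c] LL [f [fi fe]]]].
  apply: (one_HNG_lineI (o := fun _ _ => true)) => // I pr a b f1 f2 prP.
  by move=> h1 h2 h3; apply: fit_windmill_bound h1 h2 h3 wm => i; have /andP[] := prP i.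
(* Edges are oriented as in the code; those of $K_2$ components may be oriented either way. *)
apply: (one_HNG_lineI (o := fun x y => ((f x, f y) \in (c, n) :: B) || (n < f x))).
  move=> x y /fe[/orP[->//|->]|[-> _ _]]; rewrite ?orbT //.
  by rewrite ltnSn orbT.
move=> I pr a b f1 f2 prP h1 h2 h3.
by apply: (fit_bound _ h1 h2 h3 LL fi fe) => i; have /andP[] := prP i.
Qed.

Lemma code_subgraph (G H : sgraph) a phi : 0 < a.1 ->
  presents (G := H) a phi -> (has_code (@adj G) a <-> subgraph H G).
Proof.
move=> a0 [wa ia la sa ea]; split=> [[s [_ si se]]|[g gi ge]].
  exists (s \o phi) => [x y /= /si xy|x y]; first by apply/ia/xy; rewrite inE.
  rewrite ea => /orP[/se//|/se /=].
  by rewrite adj_sym.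
have [x0 _] := sa _ a0.
pose inv i := odflt x0 [pick x | phi x == i].
have invK i : i < a.1 -> phi (inv i) = i.
  move=> /sa[x xi]; rewrite /inv; case: pickP => [y /eqP//|/(_ x)].
  by rewrite xi eqxx.
exists (g \o inv); split=> // [i j ia' ja /= /gi E|p pa]; first by rewrite -(invK i) // E invK.
apply: ge; rewrite ea; have /andP[h1 h2] := wfP wa pa.
by rewrite !invK ?(ltn_trans h1) // /sE -surjective_pairing pa.
Qed.

Theorem theorem5p1 (G : sgraph) :
  (one_HNG (line G) <-> (forall H : sgraph, in_A H -> ~ subgraph H G)) /\
  ((forall H : sgraph, in_A H -> ~ subgraph H G) <->
   (exists2 H : sgraph, in_L H & subgraph G H)).
Proof.
have sub i : i < 16 -> let a := nth (0, [::]) Acodes i in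
    a \in Acodes /\ (has_code (@adj G) a <-> subgraph (nth (complete 0) Agraphs i) G).
  move=> i16 a; have aA : a \in Acodes by rewrite mem_nth.
  have /allP/(_ _ aA)/and3P[a0 _ _] := Acodes_not_hng.
  by have [phi pa] := Agraphs_presents i16; split=> //; apply: code_subgraph pa.
have hng_Afree : one_HNG (line G) -> forall H, in_A H -> ~ subgraph H G.
  move=> hng H /in_AE[i i16 ->]; have [aA eqA] := sub i i16.
  by case/eqA => s /(not_one_HNG_line aA).
have Afree_fit : (forall H, in_A H -> ~ subgraph H G) -> fits (@adj G).
  move=> noA; apply: (Afree_fits (@adj_sym G) (@adj_irr G)) => a aA.
  have i16 : index a Acodes < 16 by rewrite -[16]/(size Acodes) index_mem.
  have [_ eqA] := sub _ i16; rewrite nth_index // in eqA; move/eqA.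
  exact: noA (in_A_Agraphs i16).
have L_fit : (exists2 H, in_L H & subgraph G H) -> fits (@adj G).
  by case=> H HL GH; apply: in_L_fits HL GH.
(* The remaining implications all pass through [fits]. *)
split; split=> //.
- by move=> /Afree_fit/fits_one_HNG.
- by move=> /Afree_fit/fits_in_L.
- by move=> /L_fit/fits_one_HNG.
Qed.
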